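(* Let $f,g\in H^1(\mathbb{D})$ satisfy $|f|=|g|$ almost everywhere on $\mathbb{T}$ (in the sense of radial limits) and $|f|=|g|$ on an infinite subset $X\subset r\mathbb{T}$ for some $0<r<1$. Then $f=\lambda g$ for some $\lambda\in\mathbb{T}$.
   Context: $\mathbb{D}$ is the open unit disc, $\mathbb{T}$ the unit circle, $r\mathbb{T}=\{z:|z|=r\}$, and $H^1(\mathbb{D})$ is the Hardy space of the disc. *)

(* Defs.v *)
From HB Require Import structures.
From mathcomp Require Import all_boot all_order all_algebra.
From mathcomp Require Import all_classical all_reals all_analysis.
From mathcomp Require Import complex.
Set Implicit Arguments. Unset Strict Implicit. Unset Printing Implicit Defensive.
Import Order.TTheory GRing.Theory Num.Theory.
Import numFieldNormedType.Exports.
Local Open Scope classical_set_scope.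
Local Open Scope ring_scope.
Local Open Scope complex_scope.

(* Equip R[i] with its standard normed-module structure over itself
   (the library provides these for abstract numFieldTypes only). *)
HB.instance Definition _ (R : realType) := PseudoPointedMetric.copy R[i] R[i]^o.
HB.instance Definition _ (R : realType) := GRing.ComAlgebra.copy R[i] R[i]^o.
HB.instance Definition _ (R : realType) := Vector.copy R[i] R[i]^o.
HB.instance Definition _ (R : realType) := NormedModule.copy R[i] R[i]^o.

Definition expi (R : realType) (t : R) : R[i] := (cos t) +i* (sin t).

Definition unit_disc (R : realType) : set R[i] := [set z | `|z| < 1].

(* holomorphic on the open unit disc: complex-differentiable at every point
   (R[i] is a numFieldType, hence a normed module over itself) *)
Definition holo_disc (R : realType) (f : R[i] -> R[i]) : Prop :=
  forall z : R[i], `|z| < 1 -> derivable f z 1.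

Definition hardy1 (R : realType) (f : R[i] -> R[i]) : Prop :=
  holo_disc f /\
  exists M : R, forall r : R, 0 <= r < 1 ->
    (\int[@lebesgue_measure R]_(t in `[0%R, (2 * pi)%R]%classic)
        (complex.Re `|f (r%:C * expi t)|)%:E <= M%:E)%E.

Definition radial_limit (R : realType) (f : R[i] -> R[i]) (t : R) (l : R[i])
  : Prop :=
  (fun r : R => f (r%:C * expi t)) @ at_left 1 --> l.

(* Main.v *)
Require Import Defs.
From HB Require Import structures.
From mathcomp Require Import all_boot all_order all_algebra.
From mathcomp Require Import all_classical all_reals all_analysis.
From mathcomp Require Import complex ring lra.
From mathcomp Require finmap.
Import Order.TTheory GRing.Theory Num.Theory.
Import numFieldNormedType.Exports.
Local Open Scope classical_set_scope.
Local Open Scope ring_scope.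
Local Open Scope complex_scope.
Set Implicit Arguments. Unset Strict Implicit. Unset Printing Implicit Defensive.

(** Proof idea.  On |z| = r the condition |f| = |g| is real analytic, so it
    propagates from X to the whole circle.  Then f/g extends by reflection to a
    rational function: trading zeros a in the disc |z| < r for the factors
    r^2 - a^* z, cancelling common zeros on the circle and applying the mean
    value property to the zero-free quotient that remains, one finds nonzero
    polynomials P, Q with f Q = g P on the unit disc.  If f and g are not zero,
    their radial limits are nonzero on an infinite set, so |P| = |Q| at
    infinitely many points of both circles |z| = 1 and |z| = r.  Reflecting in
    the two circles makes P/Q invariant under z -> r^2 z, hence constant.

    The uniqueness theorem for radial limits rests on
    |h(0)|^(1/2) <= mean of |h|^(1/2) over circles: the means of |h|^(1/2) tend
    to 0 by dominated convergence if |h| has bounded means and null radial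
    limits, so h(0) = 0, and one divides by z and repeats. *)

(** Why the exponent 1/2: bounded means of |h| alone do not stop mass from escaping to the boundary,
    but |h|^(1/2) <= |h|/K + min(|h|^(1/2), K), where the first term has small mean for large K and
    the second is dominated. Null radial limits become usable without inner-outer factorization or
    maximal functions. Zeros are treated without power series or orders of vanishing: if n linear
    factors with roots in |z| <= r split off for every n, the function is zero, by a Blaschke
    estimate. This one criterion covers infinitely many zeros as well as a zero of infinite order,
    and it bounds the number of divisions made while zeros are traded. Real analyticity of |f|^2 on
    the circle is expressed by f(r e^(iw)) times the conjugate of f(r e^(i conj w)), which is
    holomorphic in a strip around the real axis because r < 1. One circle would not suffice: z and 1
    have equal modulus on |z| = 1. The second circle yields the scaling by r^2, and invariance under
    it is exploited at the lowest order at 0. *)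

Section ComplexNorm.
Variable R : realType.
Implicit Types (z w : R[i]) (x y : R).

(** The norm of [R[i]] takes its values in [R[i]]; its real part lives in the totally ordered field
    [R], where [lra] can work. *)
Definition nm z : R := complex.Re `|z|.

Lemma nmE z : `|z| = (nm z)%:C.
Proof. by rewrite /nm normc_def. Qed.

Lemma nmM z w : nm (z * w) = nm z * nm w.
Proof. by apply: (@complexI R); rewrite -nmE normrM !nmE rmorphM. Qed.

Lemma nm_ge0 z : 0 <= nm z.
Proof. by rewrite -ler0c -nmE normr_ge0. Qed.

Lemma nm0 : nm 0 = 0.
Proof. by apply: (@complexI R); rewrite -nmE normr0. Qed.

Lemma nm1 : nm 1 = 1.
Proof. by apply: (@complexI R); rewrite -nmE normr1. Qed.

Lemma nm0_eq0 z : nm z = 0 -> z = 0.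
Proof. by move=> h; apply/normr0_eq0; rewrite nmE h. Qed.

Lemma nm_eq0 z : (nm z == 0) = (z == 0).
Proof. by apply/eqP/eqP => [/nm0_eq0//|->]; rewrite nm0. Qed.

Lemma nm_gt0 z : (0 < nm z) = (z != 0).
Proof. by rewrite lt_neqAle nm_ge0 andbT eq_sym nm_eq0. Qed.

Lemma nmN z : nm (- z) = nm z.
Proof. by rewrite /nm normrN. Qed.

Lemma nm_sub z w : nm (z - w) = nm (w - z).
Proof. by rewrite -nmN opprB. Qed.

Lemma nmV z : nm z^-1 = (nm z)^-1.
Proof.
have [->|z0] := eqVneq z 0; first by rewrite invr0 nm0 invr0.
apply: (mulfI (x := nm z)); first by rewrite nm_eq0.
by rewrite -nmM !divff ?nm_eq0// nm1.
Qed.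

Lemma nm_conj z : nm z^* = nm z.
Proof. by rewrite /nm normcJ. Qed.

Lemma nm_real x : nm x%:C = `|x|.
Proof. by rewrite /nm normc_def /= expr0n addr0 sqrtr_sqr. Qed.

Lemma nm_pos x : 0 <= x -> nm x%:C = x.
Proof. by move=> x0; rewrite nm_real ger0_norm. Qed.

Lemma nmi : nm 'i = 1.
Proof. by rewrite /nm normc_def /= expr0n add0r expr1n sqrtr1. Qed.

Lemma nmX z n : nm (z ^+ n) = nm z ^+ n.
Proof. by elim: n => [|n ih]; rewrite ?expr0 ?nm1// !exprS nmM ih. Qed.

Lemma le_nmD z w : nm (z + w) <= nm z + nm w.
Proof. by rewrite -lecR rmorphD /= -!nmE ler_normD. Qed.

Lemma le_nmB z w : nm z - nm w <= nm (z - w).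
Proof. by rewrite lerBlDr -{1}(subrK w z) le_nmD. Qed.

Lemma nm_prod (I : Type) (s : seq I) (F : I -> R[i]) :
  nm (\prod_(i <- s) F i) = \prod_(i <- s) nm (F i).
Proof. by apply: (big_morph _ nmM nm1). Qed.

Lemma nm_sqr z : nm z ^+ 2 = complex.Re z ^+ 2 + complex.Im z ^+ 2.
Proof. by rewrite /nm normc_def /= sqr_sqrtr// addr_ge0 ?sqr_ge0. Qed.

Lemma mul_conjc z : z * z^* = (nm z ^+ 2)%:C.
Proof. by rewrite -sqr_normc nmE rmorphXn. Qed.

Lemma le_Re_nm z : `|complex.Re z| <= nm z.
Proof. by rewrite -lecR -nmE normc_ge_Re. Qed.

Lemma Re_le_nm z : complex.Re z <= nm z.
Proof. exact: le_trans (ler_norm _) (le_Re_nm z). Qed.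

Lemma le_Im_nm z : `|complex.Im z| <= nm z.
Proof.
by rewrite -(ler_pXn2r (n := 2)) ?nnegrE ?nm_ge0// nm_sqr real_normK ?num_real// lerDr sqr_ge0.
Qed.

Lemma nm_le_ReIm z : nm z <= `|complex.Re z| + `|complex.Im z|.
Proof.
rewrite {1}[z]complexE (le_trans (le_nmD _ _))// nmM !nm_real nmi mul1r//.
Qed.

Lemma nm_expi (t : R) : nm (expi t) = 1.
Proof. by rewrite /nm normc_def /= cos2Dsin2 sqrtr1. Qed.

Lemma expi_neq0 (t : R) : expi t != 0.
Proof. by rewrite -nm_gt0 nm_expi. Qed.

Lemma expiD (s t : R) : expi (s + t) = expi s * expi t.
Proof. by rewrite /expi cosD sinD; simpc; congr (_ +i* _); rewrite addrC; congr (_ + _); rewrite mulrC. Qed.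

Lemma expi0 : expi 0 = 1 :> R[i].
Proof. by rewrite /expi cos0 sin0. Qed.

Lemma expiN (t : R) : expi (- t) = (expi t)^*.
Proof. by rewrite /expi cosN sinN. Qed.

Lemma expi2pi : expi (2 * pi) = 1 :> R[i].
Proof. by rewrite /expi mulr2n mulrDl mul1r -mulr2n cos2pi sin2pi. Qed.

Lemma RecM (x : R) z : complex.Re (x%:C * z) = x * complex.Re z.
Proof. by case: z => a b /=; rewrite mul0r subr0. Qed.

Lemma ImcM (x : R) z : complex.Im (x%:C * z) = x * complex.Im z.
Proof. by case: z => a b /=; rewrite mul0r addr0. Qed.

End ComplexNorm.

(** * Continuity and complex differentiability at a point *)

Section ComplexCalculus.
Variable R : realType.
Implicit Types (f g : R[i] -> R[i]) (z w : R[i]).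

(** Radii are real and measured by [nm], whereas the balls of [R[i]] have radii in [R[i]]. *)
Definition ccont f z := forall e : R, 0 < e ->
  exists2 d : R, 0 < d & forall w, nm (w - z) < d -> nm (f w - f z) < e.

(* Caratheodory's form of differentiability: the difference quotient extends
   continuously; it makes products, quotients and compositions algebraic. *)
Definition cdiff f z := exists2 q : R[i] -> R[i],
  ccont q z & forall w, f w = f z + q w * (w - z).

(** The equality includes the point z itself, so values and slopes carry over. *)
Definition clocal f g z :=
  exists2 d : R, 0 < d & forall w, nm (w - z) < d -> f w = g w.

Lemma ccont_cst c z : ccont (fun=> c) z.
Proof. by move=> e e0; exists 1 => // w _; rewrite subrr nm0. Qed.

Lemma ccont_id z : ccont id z.
Proof. by move=> e e0; exists e. Qed.

Lemma ccontD f g z : ccont f z -> ccont g z -> ccont (fun w => f w + g w) z.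
Proof.
move=> hf hg e e0; have e2 : 0 < e / 2 by rewrite divr_gt0.
have [d1 d10 h1] := hf _ e2; have [d2 d20 h2] := hg _ e2.
exists (Num.min d1 d2); first by rewrite lt_min d10.
move=> w; rewrite lt_min => /andP[/h1 k1 /h2 k2].
rewrite [X in nm X](_ : _ = (f w - f z) + (g w - g z)); last by ring.
by rewrite (le_lt_trans (le_nmD _ _))//; lra.
Qed.

Lemma ccontN f z : ccont f z -> ccont (fun w => - f w) z.
Proof.
move=> hf e e0; have [d d0 h] := hf _ e0; exists d => // w /h.
by rewrite -opprD nmN.
Qed.

Lemma ccontB f g z : ccont f z -> ccont g z -> ccont (fun w => f w - g w) z.
Proof. by move=> hf hg; apply: ccontD => //; apply: ccontN. Qed.

Lemma ccont_comp f g z : ccont f (g z) -> ccont g z -> ccont (fun w => f (g w)) z.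
Proof.
by move=> hf hg e e0; have [d d0 h] := hf _ e0; have [d' d'0 h'] := hg _ d0; exists d' => // w /h' /h.
Qed.

Lemma ccontM f g z : ccont f z -> ccont g z -> ccont (fun w => f w * g w) z.
Proof.
move=> hf hg e e0.
pose K := nm (f z) + nm (g z) + 1.
have K0 : 0 < K by rewrite /K; have := nm_ge0 (f z); have := nm_ge0 (g z); lra.
(* The bound 1 keeps the product of the two errors below [e']; the three terms then total at most
   [e' * K <= e / 3]. *)
pose e' := Num.min 1 (e / (3 * K)).
have e'0 : 0 < e' by rewrite lt_min ltr01/= divr_gt0// mulr_gt0.
have e'1 : e' <= 1 by rewrite ge_min lexx.
have e'K : e' * K * 3 <= e.
  have : e' <= e / (3 * K) by rewrite ge_min lexx orbT.
  by rewrite ler_pdivlMr ?mulr_gt0//; lra.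
have [d1 d10 h1] := hf _ e'0; have [d2 d20 h2] := hg _ e'0.
exists (Num.min d1 d2); first by rewrite lt_min d10.
move=> w; rewrite lt_min => /andP[/h1 k1 /h2 k2].
rewrite [X in nm X](_ : _ = (f w - f z) * (g w - g z) + (f z * (g w - g z) + (f w - f z) * g z)); last by ring.
rewrite (le_lt_trans (le_nmD _ _))//.
have := le_nmD (f z * (g w - g z)) ((f w - f z) * g z); rewrite !nmM => k3.
have := nm_ge0 (f z); have := nm_ge0 (g z) => g0 f0.
have a0 := nm_ge0 (f w - f z); have b0 := nm_ge0 (g w - g z).
have : nm (f w - f z) * nm (g w - g z) <= e' * 1 by rewrite ler_pM//; lra.
have : nm (f z) * nm (g w - g z) <= nm (f z) * e' by rewrite ler_wpM2l// ltW.
have : nm (f w - f z) * nm (g z) <= e' * nm (g z) by rewrite ler_wpM2r// ltW.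
have : 0 < e' * K by rewrite mulr_gt0.
move: e'K; rewrite /K; lra.
Qed.

Lemma ccont_local f g z : clocal f g z -> ccont g z -> ccont f z.
Proof.
move=> [d d0 h] hg e e0; have [d' d'0 h'] := hg _ e0.
exists (Num.min d d'); first by rewrite lt_min d0.
move=> w; rewrite lt_min => /andP[k1 k2]; rewrite h// h ?subrr ?nm0//; exact: h'.
Qed.

Lemma ccont_inv_id z : z != 0 -> ccont (fun w => w^-1) z.
Proof.
move=> z0 e e0; have nz : 0 < nm z by rewrite nm_gt0.
exists (Num.min (nm z / 2) (e * (nm z ^+ 2 / 2))).
  by rewrite lt_min divr_gt0//= mulr_gt0// divr_gt0// exprn_gt0.
move=> w; rewrite lt_min => /andP[k1 k2].
have hw : nm z / 2 < nm w by have := le_nmB z (z - w); rewrite subKr nm_sub; lra.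
have w0 : w != 0 by rewrite -nm_gt0; lra.
rewrite [X in nm X](_ : _ = (z - w) * (w^-1 * z^-1)); last by field; rewrite ?z0 ?w0.
rewrite nmM nm_sub nmM !nmV -invfM ltr_pdivrMr ?mulr_gt0//; last by rewrite nm_gt0.
apply: lt_le_trans k2 _; rewrite ler_pM2l//.
by rewrite expr2 -mulrA mulrC ler_pM2r//; lra.
Qed.

Lemma ccontV f z : f z != 0 -> ccont f z -> ccont (fun w => (f w)^-1) z.
Proof. by move=> f0 hf; apply: (ccont_comp (f := fun w => w^-1)) => //; apply: ccont_inv_id. Qed.

Lemma ccont_neq0 f z : ccont f z -> f z != 0 ->
  exists2 d : R, 0 < d & forall w, nm (w - z) < d -> f w != 0.
Proof.
move=> hf; rewrite -nm_gt0 => /hf [d d0 h]; exists d => // w /h.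
by rewrite nm_sub; have := le_nmB (f z) (f z - f w); rewrite subKr -nm_gt0; lra.
Qed.

Lemma ccont_conj z : ccont (fun w => w^*) z.
Proof. by move=> e e0; exists e => // w; rewrite -rmorphB nm_conj. Qed.

Lemma cdiff_ccont f z : cdiff f z -> ccont f z.
Proof.
move=> [q hq h]; apply: (ccont_local (g := fun w => f z + q w * (w - z))).
  by exists 1 => // w _; rewrite -h.
apply: ccontD; first exact: ccont_cst.
by apply: ccontM => //; apply: ccontB; [exact: ccont_id|exact: ccont_cst].
Qed.

Lemma cdiff_cst c z : cdiff (fun=> c) z.
Proof. by exists (fun=> 0); [exact: ccont_cst|move=> w; ring]. Qed.

Lemma cdiff_id z : cdiff id z.
Proof. by exists (fun=> 1); [exact: ccont_cst|move=> w; rewrite /=; ring]. Qed.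

Lemma cdiffD f g z : cdiff f z -> cdiff g z -> cdiff (fun w => f w + g w) z.
Proof.
move=> [p hp hf] [q hq hg]; exists (fun w => p w + q w); first exact: ccontD.
by move=> w; rewrite (hf w) (hg w); ring.
Qed.

Lemma cdiffM f g z : cdiff f z -> cdiff g z -> cdiff (fun w => f w * g w) z.
Proof.
move=> [p hp hf] G; have [q hq hg] := G.
exists (fun w => p w * g w + f z * q w).
  apply: ccontD; apply: ccontM => //; [exact: cdiff_ccont|exact: ccont_cst].
by move=> w; rewrite (hf w) [in X in _ = _ + X](hg w) (hg w); ring.
Qed.

Lemma cdiffN f z : cdiff f z -> cdiff (fun w => - f w) z.
Proof.
move=> [p hp hf]; exists (fun w => - p w); first exact: ccontN.
by move=> w; rewrite (hf w); ring.
Qed.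

Lemma cdiffB f g z : cdiff f z -> cdiff g z -> cdiff (fun w => f w - g w) z.
Proof. by move=> hf hg; apply: cdiffD => //; apply: cdiffN. Qed.

Lemma cdiff_comp f g z : cdiff f (g z) -> cdiff g z -> cdiff (fun w => f (g w)) z.
Proof.
move=> [p hp hf] G; have [q hq hg] := G.
exists (fun w => p (g w) * q w).
  by apply: ccontM => //; apply: ccont_comp => //; exact: cdiff_ccont.
move=> w; rewrite (hf (g w)); congr (_ + _).
by rewrite [X in _ * X](_ : _ = q w * (w - z)); [ring|rewrite (hg w); ring].
Qed.

(** The identity in [cdiff] is demanded at every w, so the slope of g serves only near z. The slope
    of f is its own difference quotient, completed at z by the value of the slope of g. *)
Lemma cdiff_local f g z : clocal f g z -> cdiff g z -> cdiff f z.
Proof.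
move=> [d d0 h] [q hq hg].
exists (fun w => if w == z then q z else (f w - f z) / (w - z)); last first.
  move=> w; case: eqVneq => [->|wz]; first by rewrite subrr mulr0 addr0.
  by rewrite divfK ?subr_eq0// addrCA subrr addr0.
apply: (ccont_local (g := q)) => //; exists d => // w wd.
case: eqVneq => [->//|wz]; rewrite (h w wd) (h z) ?subrr ?nm0// (hg w).
by rewrite addrAC subrr add0r mulfK// subr_eq0.
Qed.

Lemma cdiff_inv_id z : z != 0 -> cdiff (fun w => w^-1) z.
Proof.
move=> z0.
have [d d0 h] := ccont_neq0 (ccont_id z) z0.
apply: (cdiff_local (g := fun w => z^-1 + - (w^-1 * z^-1) * (w - z))).
  by exists d => // w /h w0; field; rewrite ?z0 ?w0.
exists (fun w => - (w^-1 * z^-1)).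
  by apply: ccontN; apply: ccontM; [exact: ccont_inv_id|exact: ccont_cst].
by move=> w; rewrite subrr mulr0 addr0.
Qed.

Lemma cdiffV f z : f z != 0 -> cdiff f z -> cdiff (fun w => (f w)^-1) z.
Proof. by move=> f0 hf; apply: (cdiff_comp (f := fun w => w^-1)) => //; apply: cdiff_inv_id. Qed.

Lemma cdiff_conj f z : cdiff f z^* -> cdiff (fun w => (f w^*)^*) z.
Proof.
move=> [q hq hf]; exists (fun w => (q w^*)^*).
  apply: (ccont_comp (f := fun w => w^*)); first exact: ccont_conj.
  by apply: ccont_comp => //; exact: ccont_conj.
by move=> w; rewrite (hf w^*) rmorphD rmorphM rmorphB /= !conjcK.
Qed.

Lemma cdiff_prod (I : eqType) (s : seq I) (F : I -> R[i] -> R[i]) z :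
  (forall i, i \in s -> cdiff (F i) z) -> cdiff (fun w => \prod_(i <- s) F i w) z.
Proof.
elim: s => [|a s ih] h.
  by apply: (cdiff_local (g := fun=> 1)); [exists 1 => // w _; rewrite big_nil|exact: cdiff_cst].
apply: (cdiff_local (g := fun w => F a w * \prod_(i <- s) F i w)).
  by exists 1 => // w _; rewrite big_cons.
apply: cdiffM; first by apply: h; rewrite mem_head.
by apply: ih => i si; apply: h; rewrite in_cons si orbT.
Qed.

Lemma cdiff_horner (p : {poly R[i]}) z : cdiff (fun w => p.[w]) z.
Proof.
elim/poly_ind: p => [|p c ih].
  by apply: (cdiff_local (g := fun=> 0)); [exists 1 => // w _; rewrite horner0|exact: cdiff_cst].
apply: (cdiff_local (g := fun w => p.[w] * w + c)).
  by exists 1 => // w _; rewrite hornerMXaddC.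
by apply: cdiffD; [apply: cdiffM => //; exact: cdiff_id|exact: cdiff_cst].
Qed.

(** Little-o form of the derivative b, through which [derivable], [cexp] and Cauchy integrals reach
    [cdiff]. *)
Lemma cdiffP f z (b : R[i]) : (forall e : R, 0 < e -> exists2 d : R, 0 < d &
    forall w, nm (w - z) < d -> nm (f w - f z - b * (w - z)) <= e * nm (w - z)) ->
  cdiff f z.
Proof.
move=> h; exists (fun w => if w == z then b else (f w - f z) / (w - z)); last first.
  move=> w; case: eqVneq => [->|wz]; first by rewrite subrr mulr0 addr0.
  by rewrite divfK ?subr_eq0// addrCA subrr addr0.
move=> e e0; have [|d d0 hd] := h (e / 2); first by rewrite divr_gt0.
exists d => // w /hd; rewrite eqxx; case: eqVneq => [_ _|wz k]; first by rewrite subrr nm0.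
have wz' : w - z != 0 by rewrite subr_eq0.
have n0 : 0 < nm (w - z) by rewrite nm_gt0.
rewrite [X in nm X](_ : _ = (f w - f z - b * (w - z)) / (w - z)); last by field; rewrite ?wz'.
rewrite nmM nmV ltr_pdivrMr//; apply: le_lt_trans k _.
by rewrite ltr_pM2r//; lra.
Qed.

Lemma cdiff_approx f z : cdiff f z -> exists b : R[i], forall e : R, 0 < e ->
  exists2 d : R, 0 < d & forall w, nm (w - z) < d ->
    nm (f w - f z - b * (w - z)) <= e * nm (w - z).
Proof.
move=> [q hq hf]; exists (q z) => e e0; have [d d0 h] := hq _ e0; exists d => // w /h k.
rewrite (hf w) [X in nm X](_ : _ = (q w - q z) * (w - z)); last by ring.
by rewrite nmM ler_wpM2r ?nm_ge0// ltW.
Qed.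

Lemma derivable_cdiff f z : derivable f z 1 -> cdiff f z.
Proof.
move=> /cvg_ex [l /= hl]; apply: (cdiffP (b := l)) => e e0.
have eC : 0 < e%:C by rewrite ltcR.
move/cvgrPdist_lt: hl => /(_ _ eC) /nbhs_ballP [d /= d0 hd].
(* The radius d is a complex number; being positive it is real, and its real part is the wanted
   radius. *)
move: (d0); rewrite ltcE => /andP[/eqP/= i0 r0]; exists (complex.Re d) => // w wd.
have [->|wz] := eqVneq w z; first by rewrite !subrr mulr0 subr0 nm0 mulr0.
have wz' : w - z != 0 by rewrite subr_eq0.
have /hd : ball (0 : R[i]) d (w - z).
  rewrite -ball_normE /= sub0r normrN nmE.
  by rewrite ltcE /= -i0 eqxx.
move=> /(_ wz'); rewrite nmE ltcR.
change (nm (l - (w - z)^-1 * (f ((w - z) * 1 + z) - f z)) < e -> nm (f w - f z - l * (w - z)) <= e * nm (w - z)).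
rewrite mulr1 subrK => k.
rewrite [X in nm X](_ : _ = - ((w - z) * (l - (w - z)^-1 * (f w - f z)))); last by field; rewrite ?wz'.
by rewrite nmN nmM mulrC ler_wpM2r ?nm_ge0// ltW.
Qed.

End ComplexCalculus.

(** * Integrals of continuous functions over a segment *)

Section IntervalIntegral.
Variable R : realType.
Implicit Types (u v : R -> R) (G H : R -> R[i]) (a b c x y t : R).

Definition rcont u x := forall e : R, 0 < e ->
  exists2 d : R, 0 < d & forall y, `|y - x| < d -> `|u y - u x| < e.

Definition pcont G x := forall e : R, 0 < e ->
  exists2 d : R, 0 < d & forall y, `|y - x| < d -> nm (G y - G x) < e.

Definition rint a b u : R := \int[lebesgue_measure]_(x in `[a, b]) u x.

Definition cint a b G : R[i] :=
  (rint a b (fun x => complex.Re (G x))) +i* (rint a b (fun x => complex.Im (G x))).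

Lemma ReD (z w : R[i]) : complex.Re (z + w) = complex.Re z + complex.Re w.
Proof. by case: z; case: w. Qed.

Lemma ImD (z w : R[i]) : complex.Im (z + w) = complex.Im z + complex.Im w.
Proof. by case: z; case: w. Qed.

Lemma rcontP u x : rcont u x <-> {for x, continuous u}.
Proof.
split=> [h|h e e0].
  apply/cvgrPdist_lt => e e0; have [d d0 hd] := h _ e0.
  apply/nbhs_ballP; exists d => //= y.
  rewrite /ball /= => yx; rewrite distrC; apply: hd; rewrite distrC; exact: yx.
move/cvgrPdist_lt: h => /(_ _ e0) /nbhs_ballP [d /= d0 hd].
exists d => // y yd; rewrite distrC; apply: hd.
by rewrite /ball /= distrC.
Qed.

Lemma rint_integrable a b u : (forall x, a <= x <= b -> rcont u x) ->
  lebesgue_measure.-integrable `[a, b] (EFin \o u).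
Proof.
move=> h; apply: continuous_compact_integrable; first exact: segment_compact.
apply: continuous_in_subspaceT => x; rewrite inE /= in_itv /= => xab.
by apply/rcontP; exact: h.
Qed.

Lemma rcontD u v x : rcont u x -> rcont v x -> rcont (fun y => u y + v y) x.
Proof. by rewrite !rcontP => hu hv; apply: cvgD. Qed.

Lemma rcontM u v x : rcont u x -> rcont v x -> rcont (fun y => u y * v y) x.
Proof. by rewrite !rcontP => hu hv; apply: cvgM. Qed.

Lemma rcont_cst c x : rcont (fun=> c) x.
Proof. by rewrite rcontP; apply: cvg_cst. Qed.

Lemma rint_cst a b c : a <= b -> rint a b (fun=> c) = (b - a) * c.
Proof.
move=> ab; rewrite /rint Rintegral_cst//= lebesgue_measure_itv /= lte_fin.
case: ltgtP ab => // [_|->] _; first by rewrite -EFinD /= mulrC.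
by rewrite /= subrr mulr0 mul0r.
Qed.

Lemma rintD a b u v : (forall x, a <= x <= b -> rcont u x) ->
  (forall x, a <= x <= b -> rcont v x) ->
  rint a b (fun x => u x + v x) = rint a b u + rint a b v.
Proof. by move=> hu hv; rewrite /rint RintegralD//; exact: rint_integrable. Qed.

Lemma rintZ a b c u : (forall x, a <= x <= b -> rcont u x) ->
  rint a b (fun x => c * u x) = c * rint a b u.
Proof. by move=> hu; rewrite /rint RintegralZl//; exact: rint_integrable. Qed.

Lemma le_rint a b u v : (forall x, a <= x <= b -> rcont u x) ->
  (forall x, a <= x <= b -> rcont v x) ->
  (forall x, a <= x <= b -> u x <= v x) -> rint a b u <= rint a b v.
Proof.
move=> hu hv uv; apply: le_Rintegral => //; exact: rint_integrable.
Qed.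

Lemma eq_rint a b u v : (forall x, a <= x <= b -> u x = v x) -> rint a b u = rint a b v.
Proof. by move=> uv; apply: eq_Rintegral => x; rewrite inE /= in_itv /=; exact: uv. Qed.

Lemma rint_chasles c a b u : a <= c <= b -> (forall x, a <= x <= b -> rcont u x) ->
  rint a b u = rint a c u + rint c b u.
Proof.
move=> /andP[ac cb] hu; apply/eqP; rewrite addrC -subr_eq; apply/eqP.
rewrite /rint Rintegral_itvB; [|exact: rint_integrable|by rewrite bnd_simp|by rewrite bnd_simp].
apply: Rintegral_itv_obnd_cbnd.
apply: integrableS (rint_integrable hu) => //.
by apply: subset_itv; rewrite bnd_simp.
Qed.

Lemma pcont_Re G x : pcont G x -> rcont (fun y => complex.Re (G y)) x.
Proof.
move=> h e /h [d d0 hd]; exists d => // y /hd; apply: le_lt_trans.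
by rewrite -raddfB; exact: le_Re_nm.
Qed.

Lemma pcont_Im G x : pcont G x -> rcont (fun y => complex.Im (G y)) x.
Proof.
move=> h e /h [d d0 hd]; exists d => // y /hd; apply: le_lt_trans.
by rewrite -raddfB; exact: le_Im_nm.
Qed.

Lemma pcont_nm G x : pcont G x -> rcont (fun y => nm (G y)) x.
Proof.
move=> h e /h [d d0 hd]; exists d => // y /hd; apply: le_lt_trans.
by have := le_nmB (G y) (G x); have := le_nmB (G x) (G y); rewrite nm_sub; rewrite ler_norml => *; apply/andP; split; lra.
Qed.

Lemma pcontE G x : rcont (fun y => complex.Re (G y)) x ->
  rcont (fun y => complex.Im (G y)) x -> pcont G x.
Proof.
move=> hr hi e e0; have e2 : 0 < e / 2 by rewrite divr_gt0.
have [d1 d10 h1] := hr _ e2; have [d2 d20 h2] := hi _ e2.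
exists (Num.min d1 d2); first by rewrite lt_min d10.
move=> w; rewrite lt_min => /andP[/h1 k1 /h2 k2].
by rewrite (le_lt_trans (nm_le_ReIm _))// !raddfB /=; lra.
Qed.

Lemma pcont_cst (k : R[i]) x : pcont (fun=> k) x.
Proof. by move=> e e0; exists 1 => // w _; rewrite subrr nm0. Qed.

Lemma pcont_comp (f : R[i] -> R[i]) G x : ccont f (G x) -> pcont G x -> pcont (fun y => f (G y)) x.
Proof.
by move=> hf hg e e0; have [d d0 h] := hf _ e0; have [d' d'0 h'] := hg _ d0; exists d' => // w /h' /h.
Qed.

Lemma pcontD G H x : pcont G x -> pcont H x -> pcont (fun y => G y + H y) x.
Proof.
move=> hG hH; apply: pcontE.
  have -> : (fun y => complex.Re (G y + H y)) = (fun y => complex.Re (G y) + complex.Re (H y))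
    by apply/funext => y; rewrite ReD.
  exact: rcontD (pcont_Re hG) (pcont_Re hH).
have -> : (fun y => complex.Im (G y + H y)) = (fun y => complex.Im (G y) + complex.Im (H y))
    by apply/funext => y; rewrite ImD.
  exact: rcontD (pcont_Im hG) (pcont_Im hH).
Qed.

Lemma pcontZ (k : R[i]) G x : pcont G x -> pcont (fun y => k * G y) x.
Proof.
move=> hG; apply: (pcont_comp (f := fun z => k * z)) => //.
by apply: ccontM; [exact: ccont_cst|exact: ccont_id].
Qed.

Lemma pcontN G x : pcont G x -> pcont (fun y => - G y) x.
Proof.
move=> hG; apply: (pcont_comp (f := fun z => - z)) => //.
by apply: ccontN; exact: ccont_id.
Qed.

Lemma pcontB G H x : pcont G x -> pcont H x -> pcont (fun y => G y - H y) x.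
Proof. by move=> hG hH; apply: pcontD => //; apply: pcontN. Qed.

Lemma pcont_expi x : pcont (@expi R) x.
Proof.
apply: pcontE; apply/rcontP; first exact: continuous_cos.
exact: continuous_sin.
Qed.

Lemma pcont_circle (r : R) x : pcont (fun t => r%:C * expi t) x.
Proof. by apply: pcontZ; exact: pcont_expi. Qed.

Lemma eq_cint a b G H : (forall x, a <= x <= b -> G x = H x) -> cint a b G = cint a b H.
Proof. by move=> h; congr (_ +i* _); apply: eq_rint => x /h ->. Qed.

Lemma cintD a b G H : (forall x, a <= x <= b -> pcont G x) ->
  (forall x, a <= x <= b -> pcont H x) ->
  cint a b (fun x => G x + H x) = cint a b G + cint a b H.
Proof.
move=> hG hH; transitivity ((rint a b (fun x => complex.Re (G x)) + rint a b (fun x => complex.Re (H x))) +i*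
  (rint a b (fun x => complex.Im (G x)) + rint a b (fun x => complex.Im (H x)))); last by [].
congr (_ +i* _); rewrite -rintD.
- by apply: eq_rint => x _; rewrite ReD.
- by move=> x /hG /pcont_Re.
- by move=> x /hH /pcont_Re.
- by apply: eq_rint => x _; rewrite ImD.
- by move=> x /hG /pcont_Im.
- by move=> x /hH /pcont_Im.
Qed.

Lemma cint_cst a b (k : R[i]) : a <= b -> cint a b (fun=> k) = (b - a)%:C * k.
Proof. by move=> ab; rewrite /cint !rint_cst//; case: k => p q /=; simpc. Qed.

Lemma cintZ a b (k : R[i]) G : (forall x, a <= x <= b -> pcont G x) ->
  cint a b (fun x => k * G x) = k * cint a b G.
Proof.
move=> hG; case: k => p q; rewrite /cint; simpc.
have hr x : a <= x <= b -> rcont (fun y => complex.Re (G y)) x by move=> /hG /pcont_Re.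
have hi x : a <= x <= b -> rcont (fun y => complex.Im (G y)) x by move=> /hG /pcont_Im.
have hk c u x : rcont u x -> rcont (fun y => c * u y) x.
  by move=> hu; apply: rcontM => //; exact: rcont_cst.
rewrite -mulNr -!(rintZ _ hr) -!(rintZ _ hi) -!rintD; try by move=> x hx; apply: hk; auto.
by congr (_ +i* _); apply: eq_rint => x _; case: (G x) => r s /=; ring.
Qed.

Lemma cintB a b G H : (forall x, a <= x <= b -> pcont G x) ->
  (forall x, a <= x <= b -> pcont H x) ->
  cint a b (fun x => G x - H x) = cint a b G - cint a b H.
Proof.
move=> hG hH; rewrite cintD//; last by move=> x /hH; exact: pcontN.
congr (_ + _); rewrite -mulN1r -cintZ//.
by apply: eq_cint => x _; rewrite mulN1r.
Qed.

Lemma cint_chasles c a b G : a <= c <= b -> (forall x, a <= x <= b -> pcont G x) ->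
  cint a b G = cint a c G + cint c b G.
Proof.
move=> abc hG; transitivity ((rint a c (fun x => complex.Re (G x)) + rint c b (fun x => complex.Re (G x))) +i*
  (rint a c (fun x => complex.Im (G x)) + rint c b (fun x => complex.Im (G x)))); last by [].
by congr (_ +i* _); apply: rint_chasles => // x /hG; [exact: pcont_Re|exact: pcont_Im].
Qed.

Lemma cint_conj a b G : (forall x, a <= x <= b -> pcont G x) ->
  cint a b (fun x => (G x)^*) = (cint a b G)^*.
Proof.
move=> hG; rewrite /cint /=; congr (_ +i* _); first by apply: eq_rint => x _; case: (G x).
rewrite -mulN1r -rintZ; last by move=> x /hG /pcont_Im.
by apply: eq_rint => x _; case: (G x) => p q /=; rewrite mulN1r.
Qed.

(** A unimodular c rotates the integral onto the positive axis, which reduces the claim to Re (c G)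
    <= |G|. *)
Lemma le_nm_cint a b G : (forall x, a <= x <= b -> pcont G x) ->
  nm (cint a b G) <= rint a b (fun x => nm (G x)).
Proof.
move=> hG; set I := cint a b G.
have [I0|I0] := eqVneq I 0.
  by rewrite I0 nm0; apply: Rintegral_ge0 => x _; exact: nm_ge0.
have n0 : 0 < nm I by rewrite nm_gt0.
pose c := I^* / (nm I)%:C.
have c1 : nm c = 1 by rewrite nmM nmV nm_pos ?nm_ge0// nm_conj divff// lt0r_neq0.
have cI : c * I = (nm I)%:C.
  rewrite /c mulrAC [_ * I]mulrC mul_conjc rmorphXn /= expr2 mulfK//.
  by rewrite -(rmorph0 (real_complex R)) (inj_eq (@complexI R)) lt0r_neq0.
have -> : nm I = complex.Re (cint a b (fun x => c * G x)) by rewrite cintZ// -/I cI.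
apply: le_rint => [x /hG h|x /hG|x _]; last by rewrite -[leRHS]mul1r -c1 -nmM Re_le_nm.
  exact/pcont_Re/pcontZ.
exact: pcont_nm.
Qed.

Lemma cint_bound a b G k (e : R) : a <= b -> (forall x, a <= x <= b -> pcont G x) ->
  (forall x, a <= x <= b -> nm (G x - k) <= e) ->
  nm (cint a b G - (b - a)%:C * k) <= (b - a) * e.
Proof.
move=> ab hG h; rewrite -cint_cst// -cintB//; last by move=> x _; exact: pcont_cst.
rewrite -rint_cst//.
have hGk x : a <= x <= b -> pcont (fun x => G x - k) x.
  by move=> /hG hx; apply: pcontB => //; exact: pcont_cst.
apply: le_trans (le_nm_cint hGk) _; apply: le_rint => // x; last by move=> _; exact: rcont_cst.
by move=> /hGk; exact: pcont_nm.
Qed.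

Lemma cint_le a b G (e : R) : a <= b -> (forall x, a <= x <= b -> pcont G x) ->
  (forall x, a <= x <= b -> nm (G x) <= e) -> nm (cint a b G) <= (b - a) * e.
Proof.
move=> ab hG h; rewrite -[X in nm X]subr0 -(mulr0 (b - a)%:C); apply: cint_bound => // x /h.
by rewrite subr0.
Qed.

End IntervalIntegral.

(** * Goursat's theorem on rectangles *)

Section Goursat.
Variable R : realType.
Implicit Types (F : R[i] -> R[i]) (a b c d s t : R).

(** The counterclockwise boundary integral with opposite sides paired: only differences of F occur,
    so constants drop out at once. *)
Definition rect_int F a b c d : R[i] :=
  cint a b (fun s => F (s +i* c) - F (s +i* d)) +
  'i * cint c d (fun t => F (b +i* t) - F (a +i* t)).

Lemma pcont_hline c x : pcont (fun s : R => s +i* c) x.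
Proof.
apply: pcontE; last exact: rcont_cst.
by move=> e e0; exists e.
Qed.

Lemma pcont_vline c x : pcont (fun s : R => c +i* s) x.
Proof.
apply: pcontE; first exact: rcont_cst.
by move=> e e0; exists e.
Qed.

Definition crect a b c d (z : R[i]) :=
  (a <= complex.Re z <= b) && (c <= complex.Im z <= d).

Lemma pcont_hdiff F a b c d : c <= d -> (forall z, crect a b c d z -> ccont F z) ->
  forall x, a <= x <= b -> pcont (fun s => F (s +i* c) - F (s +i* d)) x.
Proof.
move=> cd hF x xab; apply: pcontB; apply: pcont_comp; try exact: pcont_hline.
  by apply: hF; rewrite /crect /= xab lexx.
by apply: hF; rewrite /crect /= xab lexx andbT.
Qed.

Lemma pcont_vdiff F a b c d : a <= b -> (forall z, crect a b c d z -> ccont F z) ->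
  forall x, c <= x <= d -> pcont (fun t => F (b +i* t) - F (a +i* t)) x.
Proof.
move=> ab hF x xab; apply: pcontB; apply: pcont_comp; try exact: pcont_vline.
  by apply: hF; rewrite /crect /= xab lexx andbT ab.
by apply: hF; rewrite /crect /= xab lexx ab.
Qed.

Lemma rect_int_hsplit F m a b c d : a <= m <= b -> c <= d ->
  (forall z, crect a b c d z -> ccont F z) ->
  rect_int F a b c d = rect_int F a m c d + rect_int F m b c d.
Proof.
move=> amb cd hF; have /andP[am mb] := amb; have ab := le_trans am mb.
rewrite /rect_int (cint_chasles amb); last exact: pcont_hdiff hF.
rewrite addrACA; congr (_ + _); rewrite -mulrDr -cintD; last 2 first.
- apply: (pcont_vdiff (F := F)) => // z /andP[/andP[h1 h2] h3]; apply: hF.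
  by rewrite /crect h3 h1 (le_trans h2 mb).
- apply: (pcont_vdiff (F := F)) => // z /andP[/andP[h1 h2] h3]; apply: hF.
  by rewrite /crect h3 h2 (le_trans am h1).
by congr (_ * _); apply: eq_cint => x _; ring.
Qed.

Lemma rect_int_vsplit F m a b c d : c <= m <= d -> a <= b ->
  (forall z, crect a b c d z -> ccont F z) ->
  rect_int F a b c d = rect_int F a b c m + rect_int F a b m d.
Proof.
move=> cmd ab hF; have /andP[cm md] := cmd; have cd := le_trans cm md.
rewrite /rect_int [in LHS](cint_chasles cmd); last exact: pcont_vdiff hF.
rewrite addrACA -mulrDr; congr (_ + _); rewrite -cintD; last 2 first.
- apply: (pcont_hdiff (F := F)) => // z /andP[h3 /andP[h1 h2]]; apply: hF.
  by rewrite /crect h3 h1 (le_trans h2 md).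
- apply: (pcont_hdiff (F := F)) => // z /andP[h3 /andP[h1 h2]]; apply: hF.
  by rewrite /crect h3 h2 (le_trans cm h1).
by apply: eq_cint => x _; ring.
Qed.

(** Each pair of opposite points contributes k (z - w) up to 2eL, and the exact contributions of k
    cancel between the two pairs of sides. What remains is (b - a) 2eL + (d - c) 2eL. *)
Lemma rect_int_approx F a b c d (p k : R[i]) (e L : R) : a <= b -> c <= d -> 0 <= e ->
  (forall z, crect a b c d z -> ccont F z) -> crect a b c d p ->
  (b - a) + (d - c) = L ->
  (forall z, crect a b c d z -> nm (F z - F p - k * (z - p)) <= e * nm (z - p)) ->
  nm (rect_int F a b c d) <= 2 * e * L ^+ 2.
Proof.
move=> ab cd e0 hF pQ hL hk.
have hz z : crect a b c d z -> nm (F z - F p - k * (z - p)) <= e * L.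
  move=> zQ; apply: le_trans (hk _ zQ) _; rewrite ler_wpM2l//.
  apply: le_trans (nm_le_ReIm _) _; rewrite -hL.
  move: zQ pQ; rewrite /crect; case: (z) => z1 z2; case: (p) => p1 p2 /=.
  move=> /andP[/andP[? ?] /andP[? ?]] /andP[/andP[? ?] /andP[? ?]].
  by apply: lerD; rewrite ler_norml; apply/andP; split; lra.
have hzw z w : crect a b c d z -> crect a b c d w ->
    nm (F z - F w - k * (z - w)) <= 2 * (e * L).
  move=> zQ wQ.
  rewrite [X in nm X](_ : _ = (F z - F p - k * (z - p)) - (F w - F p - k * (w - p))); last by ring.
  apply: le_trans (le_nmD _ _) _; rewrite nmN.
  by have := hz _ zQ; have := hz _ wQ; lra.
pose k1 := k * (0 +i* (c - d)); pose k2 := k * (b - a)%:C.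
have b1 : nm (cint a b (fun s => F (s +i* c) - F (s +i* d)) - (b - a)%:C * k1) <=
    (b - a) * (2 * (e * L)).
  apply: cint_bound => //; first exact: pcont_hdiff hF.
  move=> x xab; rewrite /k1.
  have -> : 0 +i* (c - d) = (x +i* c) - (x +i* d) by apply/eqP; rewrite eq_complex /= subrr !eqxx.
  by apply: hzw; rewrite /crect /= xab lexx ?andbT.
have b2 : nm (cint c d (fun t => F (b +i* t) - F (a +i* t)) - (d - c)%:C * k2) <=
    (d - c) * (2 * (e * L)).
  apply: cint_bound => //; first exact: pcont_vdiff hF.
  move=> x xab; rewrite /k2.
  have -> : (b - a)%:C = (b +i* x) - (a +i* x) by apply/eqP; rewrite eq_complex /= subrr !eqxx.
  by apply: hzw; rewrite /crect /= xab lexx ?andbT ab.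
have k0 : (b - a)%:C * k1 + 'i * ((d - c)%:C * k2) = 0.
  rewrite /k1 /k2; case: (k) => u v; simpc.
  by apply/eqP; rewrite eq_complex /=; apply/andP; split; apply/eqP; ring.
rewrite /rect_int; set A := cint a b _ in b1 *; set B := cint c d _ in b2 *.
rewrite [X in nm X](_ : _ = (A - (b - a)%:C * k1) + 'i * (B - (d - c)%:C * k2)); last first.
  by rewrite mulrBr addrACA -opprD k0 subr0.
apply: le_trans (le_nmD _ _) _; rewrite nmM nmi mul1r.
have -> : 2 * e * L ^+ 2 = (b - a) * (2 * (e * L)) + (d - c) * (2 * (e * L)).
  by rewrite -hL; ring.
exact: lerD.
Qed.

Lemma rect_int_bisect F a b c d (M : R) : a <= b -> c <= d ->
  (forall z, crect a b c d z -> ccont F z) -> 4 * M < nm (rect_int F a b c d) ->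
  exists a' b' c' d', [/\ a <= a' <= b' /\ b' <= b, c <= c' <= d' /\ d' <= d,
    b' - a' = (b - a) / 2, d' - c' = (d - c) / 2 & M < nm (rect_int F a' b' c' d')].
Proof.
move=> ab cd hF.
pose m := (a + b) / 2; pose n := (c + d) / 2.
have am : a <= m <= b by rewrite /m; lra.
have cn : c <= n <= d by rewrite /n; lra.
have [am' mb'] := andP am; have [cn' nd'] := andP cn.
rewrite (rect_int_hsplit am) // (rect_int_vsplit cn am'); last first.
  by move=> z /andP[/andP[h1 h2] h3]; apply: hF; rewrite /crect h3 h1 (le_trans h2 mb').
rewrite (rect_int_vsplit cn mb'); last first.
  by move=> z /andP[/andP[h1 h2] h3]; apply: hF; rewrite /crect h3 h2 (le_trans am' h1).
set A := rect_int _ _ _ _ _; set B := rect_int _ _ _ _ _.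
set C := rect_int _ _ _ _ _; set D := rect_int _ _ _ _ _ => h.
have := le_nmD (A + B) (C + D); have := le_nmD A B; have := le_nmD C D => h1 h2 h3.
have [hA|hA] := ltP M (nm A).
  by exists a, m, c, n; split => //; rewrite /m /n; lra.
have [hB|hB] := ltP M (nm B).
  by exists a, m, n, d; split => //; rewrite /m /n; lra.
have [hC|hC] := ltP M (nm C).
  by exists m, b, c, n; split => //; rewrite /m /n; lra.
have [hD|hD] := ltP M (nm D).
  by exists m, b, n, d; split => //; rewrite /m /n; lra.
lra.
Qed.

Lemma half_pow_small (L dl : R) : 0 < dl -> exists n, L / 2 ^+ n < dl.
Proof.
move=> d0; pose n := Num.bound (L / dl); exists n.
rewrite ltr_pdivrMr ?exprn_gt0// -ltr_pdivrMl// mulrC.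
apply: le_lt_trans (ler_norm _) _; apply: lt_le_trans (archi_boundP (normr_ge0 _)) _.
rewrite /n.
have -> : Num.bound `|L / dl| = Num.bound (L / dl) by rewrite /Num.bound normr_id.
by rewrite -natrX ler_nat ltnW// ltn_expl.
Qed.

(** Bisection keeps the integral strictly above e (L / 2^n)^2, while the linear approximation at the
    common point of the nested rectangles makes it at most that for large n. *)
Theorem goursat F a b c d : a <= b -> c <= d ->
  (forall z, crect a b c d z -> cdiff F z) -> rect_int F a b c d = 0.
Proof.
move=> ab cd hF; apply/eqP; rewrite -nm_eq0 eq_le nm_ge0 andbT; apply/ler_addgt0Pr => e0 e0_gt0.
rewrite add0r leNgt; apply/negP => hJ.
have hFc z : crect a b c d z -> ccont F z by move=> /hF /cdiff_ccont.
pose L := (b - a) + (d - c).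
have L0 : 0 <= L by rewrite /L; lra.
(* The summand 1 gives e L^2 < e0 even for a degenerate rectangle. *)
pose e := e0 / (1 + L ^+ 2).
have L21 : 0 < 1 + L ^+ 2 by rewrite ltr_pwDl// sqr_ge0.
have e_gt0 : 0 < e by rewrite divr_gt0.
have heL : e * L ^+ 2 < e0.
  rewrite /e mulrAC ltr_pdivrMr// mulrDr mulr1; lra.
pose T := ((R * R) * (R * R))%type.
pose good (n : nat) (Q : T) := [/\ a <= Q.1.1 <= Q.1.2 /\ Q.1.2 <= b,
  c <= Q.2.1 <= Q.2.2 /\ Q.2.2 <= d, Q.1.2 - Q.1.1 = (b - a) / 2 ^+ n,
  Q.2.2 - Q.2.1 = (d - c) / 2 ^+ n &
  e * (L / 2 ^+ n) ^+ 2 < nm (rect_int F Q.1.1 Q.1.2 Q.2.1 Q.2.2)].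
have step (nQ : nat * T) : exists Q' : T, good nQ.1 nQ.2 -> good nQ.1.+1 Q' /\
   [/\ nQ.2.1.1 <= Q'.1.1, Q'.1.2 <= nQ.2.1.2, nQ.2.2.1 <= Q'.2.1 & Q'.2.2 <= nQ.2.2.2].
  case: nQ => n [[a1 b1] [c1 d1]] /=.
  (* [choice] wants a successor for every input; outside the invariant any rectangle serves. *)
  have [g|] := pselect (good n ((a1, b1), (c1, d1))); last by exists ((0, 0), (0, 0)).
  have [/= [/andP[? ?] ?] [/andP[? ?] ?] hb hd hn] := g.
  have [||z zQ||a' [b' [c' [d' [/= [/andP[? ?] ?] [/andP[? ?] ?] hb' hd' hn']]]]] :=
      @rect_int_bisect F a1 b1 c1 d1 (e * (L / 2 ^+ n.+1) ^+ 2) => //.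
    apply: hFc; move: zQ => /andP[/andP[? ?] /andP[? ?]].
    by apply/andP; split; apply/andP; split; lra.
    apply: le_lt_trans hn; rewrite le_eqVlt; apply/orP; left; apply/eqP.
    by rewrite [2 ^+ n.+1]exprS; field; rewrite expf_neq0.
  exists ((a', b'), (c', d')) => _; split => //=.
  split => //=; first by split; [apply/andP; split|]; lra.
  - by split; [apply/andP; split|]; lra.
  - by rewrite hb' hb [2 ^+ n.+1]exprS; field; rewrite expf_neq0.
  - by rewrite hd' hd [2 ^+ n.+1]exprS; field; rewrite expf_neq0.
have [f hf] := choice step.
pose Q := fix Q n := if n is m.+1 then f (m, Q m) else ((a, b), (c, d)).
have Qgood n : good n (Q n).
  elim: n => [|n ih]; last by have [] := hf (n, Q n) ih.
  split => //=; rewrite ?lexx ?ab ?cd ?expr0 ?divr1//; exact: lt_trans heL hJ.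
have Qmon n := (hf (n, Q n) (Qgood n)).2.
have Qmono n m : (n <= m)%N -> [/\ (Q n).1.1 <= (Q m).1.1, (Q m).1.2 <= (Q n).1.2,
    (Q n).2.1 <= (Q m).2.1 & (Q m).2.2 <= (Q n).2.2].
  move=> /subnK <-; elim: (m - n)%N => [//|k [h1 h2 h3 h4]].
  have /= [h5 h6 h7 h8] := Qmon (k + n)%N; rewrite ?addSn /=; split.
  - exact: le_trans h1 h5.
  - exact: le_trans h6 h2.
  - exact: le_trans h3 h7.
  - exact: le_trans h8 h4.
have Qle n m : (Q n).1.1 <= (Q m).1.2 /\ (Q n).2.1 <= (Q m).2.2.
  have [h1 _ h3 _] := Qmono _ _ (leq_maxl n m).
  have [_ h6 _ h8] := Qmono _ _ (leq_maxr n m).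
  have [[/andP[_ h9] _] [/andP[_ h10] _] _ _ _] := Qgood (maxn n m).
  by split; [apply: le_trans h1 (le_trans h9 h6)|apply: le_trans h3 (le_trans h10 h8)].
(* The suprema of the left and of the lower ends are the coordinates of the common point. *)
pose s := sup (range (fun n => (Q n).1.1)); pose t := sup (range (fun n => (Q n).2.1)).
have sQ n : (Q n).1.1 <= s <= (Q n).1.2.
  apply/andP; split.
    apply: sup_ubound; last by exists n.
    by exists (Q 0).1.2 => _ [m _ <-]; have [] := Qle m 0.
  by apply: ge_sup; [by exists (Q 0).1.1; exists 0%N|move=> _ [m _ <-]; have [] := Qle m n].
have tQ n : (Q n).2.1 <= t <= (Q n).2.2.
  apply/andP; split.
    apply: sup_ubound; last by exists n.
    by exists (Q 0).2.2 => _ [m _ <-]; have [] := Qle m 0.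
  by apply: ge_sup; [by exists (Q 0).2.1; exists 0%N|move=> _ [m _ <-]; have [] := Qle m n].
pose p := s +i* t.
have pQ n : crect (Q n).1.1 (Q n).1.2 (Q n).2.1 (Q n).2.2 p by rewrite /crect /= sQ tQ.
have [k hk] := cdiff_approx (hF p (pQ 0)).
(* Half of e, since [rect_int_approx] loses a factor 2. *)
have [dl dl0 hdl] := hk (e / 2) (divr_gt0 e_gt0 (ltr0n _ 2)).
have [n hn] := half_pow_small L dl0.
have [/= [/andP[q1 q2] q3] [/andP[q4 q5] q6] hb hd] := Qgood n.
apply/negP; rewrite -leNgt.
have -> : e * (L / 2 ^+ n) ^+ 2 = 2 * (e / 2) * (L / 2 ^+ n) ^+ 2 by field; rewrite expf_neq0.
apply: (rect_int_approx (p := p) (k := k)) => //.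
- by lra.
- move=> z /andP[/andP[? ?] /andP[? ?]]; apply: hFc.
  by apply/andP; split; apply/andP; split; lra.
- by rewrite hb hd -mulrDl.
move=> z zQ; apply: hdl; apply: le_lt_trans hn.
apply: le_trans (nm_le_ReIm _) _; rewrite /L mulrDl -hb -hd.
move: zQ (pQ n); rewrite /crect; case: (z) => z1 z2 /=.
move=> /andP[/andP[? ?] /andP[? ?]] /andP[/andP[? ?] /andP[? ?]].
by apply: lerD; rewrite ler_norml; apply/andP; split; lra.
Qed.

End Goursat.

(** * The complex exponential *)

Section ComplexExp.
Variable R : realType.
Implicit Types (z w : R[i]).

Definition cexp z : R[i] := (expR (complex.Re z))%:C * expi (complex.Im z).

Lemma cexpD z w : cexp (z + w) = cexp z * cexp w.
Proof. by rewrite /cexp ReD ImD expRD expiD rmorphM mulrACA. Qed.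

Lemma cexp0 : cexp 0 = 1.
Proof. by rewrite /cexp /= expR0 expi0 mulr1. Qed.

Lemma nm_cexp z : nm (cexp z) = expR (complex.Re z).
Proof. by rewrite nmM nm_expi mulr1 nm_pos// expR_ge0. Qed.

Lemma is_derive_approx (u : R -> R) (x l : R) : is_derive x 1 u l ->
  forall e : R, 0 < e -> exists2 d : R, 0 < d &
    forall h, `|h| < d -> `|u (h + x) - u x - l * h| <= e * `|h|.
Proof.
move=> [du dl] e e0.
have : h^-1 *: (u (h *: 1 + x) - u x) @[h --> 0^'] --> l by rewrite -dl; exact: du.
move/cvgrPdist_lt => /(_ _ e0) /nbhs_ballP [d /= d0 hd]; exists d => // h hh.
have [->|h0] := eqVneq h 0; first by rewrite add0r subrr mulr0 subr0 normr0 mulr0.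
have /hd : ball 0 d h by rewrite /ball /= sub0r normrN.
move=> /(_ h0).
change (`|l - h^-1 * (u (h * 1 + x) - u x)| < e -> `|u (h + x) - u x - l * h| <= e * `|h|).
rewrite mulr1 => k.
rewrite [X in `|X|](_ : _ = - (h * (l - h^-1 * (u (h + x) - u x)))); last by field.
by rewrite normrN normrM mulrC ler_wpM2r// ltW.
Qed.

Lemma cdiff_cexp0 : cdiff cexp 0.
Proof.
apply: (cdiffP (b := 1)) => e0 e0_gt0.
(* The errors add up to e|s| + 5e|t| <= 6eN; the requirement N < e / 2 gives |exp s - 1| <= e. *)
pose e := Num.min 1 (e0 / 6).
have e_gt0 : 0 < e by rewrite lt_min ltr01 divr_gt0.
have e1 : e <= 1 by rewrite ge_min lexx.
have ee0 : 6 * e <= e0 by rewrite -ler_pdivlMl// mulrC ge_min lexx orbT.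
have [d1 d10 h1] := is_derive_approx (is_derive_expR 0) e_gt0.
have [d2 d20 h2] := is_derive_approx (is_derive_cos 0) e_gt0.
have [d3 d30 h3] := is_derive_approx (is_derive_sin 0) e_gt0.
exists (Num.min (Num.min d1 d2) (Num.min d3 (e / 2))).
  by rewrite !lt_min d10 d20 d30 divr_gt0.
move=> w; rewrite !subr0 !lt_min => /andP[/andP[w1 w2] /andP[w3 w4]].
rewrite mul1r cexp0.
case: w w1 w2 w3 w4 => s t; have := le_Re_nm (s +i* t); have := le_Im_nm (s +i* t).
set N := nm (s +i* t) => /= tN sN w1 w2 w3 w4.
have {h1} := h1 s (le_lt_trans sN w1).
have {h2} := h2 t (le_lt_trans tN w2).
have {h3} := h3 t (le_lt_trans tN w3).
rewrite !addr0 expR0 cos0 sin0 oppr0 mul0r !mul1r !subr0 addr0 => h3 h2 h1.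
apply: le_trans (nm_le_ReIm _) _.
have s0 := normr_ge0 s; have t0 := normr_ge0 t.
have E1 : `|expR s - 1| <= 2 * `|s|.
  rewrite (_ : expR s - 1 = (expR s - 1 - s) + s); last by ring.
  have := ler_normD (expR s - 1 - s) s.
  have : e * `|s| <= 1 * `|s| by rewrite ler_wpM2r.
  rewrite mul1r; lra.
have E2 : 0 <= expR s <= 2.
  rewrite expR_ge0 /=; have := ler_norm (expR s - 1); lra.
have -> : complex.Re (cexp (s +i* t) - 1 - (s +i* t)) = (expR s - 1 - s) + expR s * (cos t - 1).
  by rewrite /cexp /=; ring.
have -> : complex.Im (cexp (s +i* t) - 1 - (s +i* t)) = expR s * (sin t - t) + (expR s - 1) * t.
  by rewrite /cexp /=; ring.
have [E3 E4] := andP E2.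
have := ler_normD (expR s - 1 - s) (expR s * (cos t - 1)).
have := ler_normD (expR s * (sin t - t)) ((expR s - 1) * t).
rewrite !normrM (ger0_norm E3).
have : expR s * `|cos t - 1| <= 2 * (e * `|t|) by rewrite ler_pM.
have : expR s * `|sin t - t| <= 2 * (e * `|t|) by rewrite ler_pM.
have : `|expR s - 1| * `|t| <= e * `|t| by rewrite ler_wpM2r//; lra.
have : e * `|t| <= e * N by rewrite ler_pM2l.
have : e * `|s| <= e * N by rewrite ler_pM2l.
have : 6 * e * N <= e0 * N by rewrite ler_wpM2r// (le_trans s0).
lra.
Qed.

Lemma cdiff_cexp z : cdiff cexp z.
Proof.
apply: (cdiff_local (g := fun w => cexp z * cexp (w - z))).
  by exists 1 => // w _; rewrite -cexpD addrCA subrr addr0.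
apply: cdiffM; first exact: cdiff_cst.
apply: (cdiff_comp (f := cexp)); first by rewrite subrr; exact: cdiff_cexp0.
by apply: cdiffB; [exact: cdiff_id|exact: cdiff_cst].
Qed.

End ComplexExp.

(** * Circle integrals and the mean value property *)

Section MeanValue.
Variable R : realType.
Implicit Types (f : R[i] -> R[i]) (z w : R[i]) (x y t : R).

(** Compactness of the segment of angles gives one d for all t. The point w may leave the circle,
    which is what lets the radius vary in [circle_int_cont]. *)
Lemma ccont_circle_uniform f x : (forall t, ccont f (x%:C * expi t)) ->
  forall e : R, 0 < e -> exists2 d : R, 0 < d &
    forall t w, 0 <= t <= 2 * pi -> nm (w - x%:C * expi t) < d ->
      nm (f w - f (x%:C * expi t)) < e.
Proof.
move=> hf e e0; have e2 : 0 < e / 2 by rewrite divr_gt0.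
pose P (d : R) t := forall w, nm (w - x%:C * expi t) < d -> nm (f w - f (x%:C * expi t)) < e.
have := @segment_compact R 0 (2 * pi).
rewrite compact_near_coveringP => /(_ _ (at_right (0 : R)) P _) hK.
have hP : \forall d \near 0^'+, `[0, 2 * pi] `<=` P d.
  apply: hK => t _.
  have [d d0 hd] := hf t _ e2.
  have [d' d'0 hd'] := pcont_circle x t (divr_gt0 d0 (ltr0n _ 2)).
  exists (ball t d', [set y : R | y < d / 2]).
    split => /=; first exact: nbhsx_ballx.
    by apply: nbhs_right_lt; rewrite divr_gt0.
  move=> [t' y] /= [tt' yd] w hw.
  have ht : nm (x%:C * expi t' - x%:C * expi t) < d / 2.
    by apply: hd'; rewrite distrC; exact: tt'.
  have k1 := hd (x%:C * expi t').
  have k2 : nm (w - x%:C * expi t) < d.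
    rewrite (_ : w - x%:C * expi t = (w - x%:C * expi t') + (x%:C * expi t' - x%:C * expi t)); last by ring.
    by apply: le_lt_trans (le_nmD _ _) _; lra.
  have := hd _ k2; have := k1 ltac:(lra) => k3 k4.
  rewrite (_ : f w - f (x%:C * expi t') = (f w - f (x%:C * expi t)) - (f (x%:C * expi t') - f (x%:C * expi t))); last by ring.
  by apply: le_lt_trans (le_nmD _ _) _; rewrite nmN; lra.
have : \forall d \near 0^'+, 0 < d /\ `[0, 2 * pi] `<=` P d.
  by apply: filterI; [exact: nbhs_right_gt|exact: hP].
case/filter_ex => d [d0 hd]; exists d => // t w ht; apply: hd.
by rewrite /= in_itv.
Qed.

(** The measure is dt, not dw: no factor i appears in mean values, and Cauchy's kernel takes the
    form w / (w - z). *)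
Definition circle_int f x := cint 0 (2 * pi) (fun t => f (x%:C * expi t)).

Lemma pi2_ge0 : 0 <= 2 * pi :> R.
Proof. by rewrite mulr_ge0// pi_ge0. Qed.

Lemma nm_circle x t : 0 <= x -> nm (x%:C * expi t) = x.
Proof. by move=> x0; rewrite nmM nm_expi mulr1 nm_pos. Qed.

Lemma pcont_on_circle f x t : ccont f (x%:C * expi t) -> pcont (fun t => f (x%:C * expi t)) t.
Proof. by move=> h; apply: pcont_comp => //; exact: pcont_circle. Qed.

Lemma circle_int_cont f rho x : (forall z, nm z <= rho -> ccont f z) -> 0 <= x <= rho ->
  forall e : R, 0 < e -> exists2 d : R, 0 < d & forall y, 0 <= y <= rho -> `|y - x| < d ->
    nm (circle_int f y - circle_int f x) <= e.
Proof.
move=> hf /andP[x0 xr] e e0.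
have hcirc y t : 0 <= y <= rho -> ccont f (y%:C * expi t).
  by move=> /andP[y0 yr]; apply: hf; rewrite nm_circle.
have e2 : 0 < e / (2 * pi) by rewrite divr_gt0// mulr_gt0// pi_gt0.
have [|d d0 hd] := ccont_circle_uniform (f := f) (x := x) _ e2.
  by move=> t; apply: hcirc; rewrite x0.
exists d => // y yr yx; rewrite /circle_int -cintB; last 2 first.
- by move=> t _; apply: pcont_on_circle; exact: hcirc.
- by move=> t _; apply: pcont_on_circle; apply: hcirc; rewrite x0.
have -> : e = (2 * pi - 0) * (e / (2 * pi)).
  by rewrite subr0 mulrC divfK// mulf_neq0// lt0r_neq0// pi_gt0.
apply: cint_le; first exact: pi2_ge0.
  move=> t _; apply: pcontB; apply: pcont_on_circle; apply: hcirc => //.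
  by rewrite x0.
move=> t ht; apply/ltW/hd => //.
by rewrite -mulrBl nmM nm_expi mulr1 -rmorphB nm_real.
Qed.

(** The exponential maps the rectangle [ln x, ln y] x [0, 2 pi] onto the annulus. In Goursat's
    theorem for f o exp the horizontal sides cancel by periodicity and the vertical ones are the two
    circle integrals. *)
Lemma circle_int_annulus f x y : 0 < x -> x <= y ->
  (forall z, x <= nm z <= y -> cdiff f z) -> circle_int f x = circle_int f y.
Proof.
move=> x0 xy hf; have y0 := lt_le_trans x0 xy.
have lxy : ln x <= ln y by rewrite ler_ln ?posrE.
have hx : expR (ln x) = x by rewrite lnK ?posrE.
have hy : expR (ln y) = y by rewrite lnK ?posrE.
have /(@goursat R (fun w => f (cexp w)) _ _ _ _ lxy pi2_ge0) : forall w,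
    crect (ln x) (ln y) 0 (2 * pi) w -> cdiff (fun w => f (cexp w)) w.
  move=> w /andP[/andP[h1 h2] _]; apply: cdiff_comp; last exact: cdiff_cexp.
  by apply: hf; rewrite nm_cexp -{1}hx -{1}hy !ler_expR h1.
have hc (z : R) t : x <= z <= y -> ccont f (z%:C * expi t).
  move=> /andP[xz zy]; apply/cdiff_ccont/hf; rewrite nm_circle ?xz//.
  exact: le_trans (ltW x0) xz.
rewrite /rect_int (eq_cint (H := fun=> 0)); last first.
  by move=> s _; rewrite /cexp /= expi2pi expi0 subrr.
rewrite cint_cst// mulr0 add0r /cexp /= hx hy cintB; last 2 first.
- by move=> t _; apply: pcont_on_circle; apply: hc; rewrite xy lexx.
- by move=> t _; apply: pcont_on_circle; apply: hc; rewrite xy lexx.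
move/eqP; rewrite mulf_eq0 => /orP[/eqP/(congr1 (@nm R))|].
  by rewrite nmi nm0 => /eqP; rewrite oner_eq0.
by rewrite subr_eq0 => /eqP.
Qed.

Lemma eq_of_nm_le z w : (forall e : R, 0 < e -> nm (z - w) <= e) -> z = w.
Proof.
move=> h; apply/eqP; rewrite -subr_eq0 -nm_eq0 eq_le nm_ge0 andbT.
by apply/ler_addgt0Pr => e /h; rewrite add0r.
Qed.

(** Induction on a list covering the exceptional points strictly between the two circles: the range
    of radii is cut at the modulus of the head. With none left, the open annulus is regular and
    continuity in the radius reaches its two boundary circles. *)
Lemma circle_int_const (S : seq R[i]) f rho : (forall z, nm z <= rho -> ccont f z) ->
  (forall z, nm z < rho -> z \notin S -> cdiff f z) ->
  forall (s : seq R[i]) x y, 0 < x -> x <= y -> y <= rho ->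
  (forall a, a \in S -> x < nm a < y -> a \in s) -> circle_int f x = circle_int f y.
Proof.
move=> hc hd; elim=> [|a s ih] x y x0; rewrite le_eqVlt => /orP[/eqP->//|xy] yr hs.
  apply: eq_of_nm_le => e e0; have e2 : 0 < e / 2 by rewrite divr_gt0.
  have xr : 0 <= x <= rho by rewrite ltW//= ltW// (lt_le_trans xy).
  have yr' : 0 <= y <= rho by rewrite yr ltW// (lt_trans x0).
  have [d1 d10 h1] := circle_int_cont hc xr e2.
  have [d2 d20 h2] := circle_int_cont hc yr' e2.
  (* A third of the width leaves x + d < y - d, so the closed annulus between these radii contains
     no exceptional point. *)
  pose d := Num.min (Num.min d1 d2) (y - x) / 3.
  have d0 : 0 < d by rewrite divr_gt0// !lt_min d10 d20 subr_gt0.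
  have dd1 : 3 * d <= d1 by rewrite /d mulrC divfK// !ge_min lexx.
  have dd2 : 3 * d <= d2 by rewrite /d mulrC divfK// !ge_min lexx orbT.
  have ddx : 3 * d <= y - x by rewrite /d mulrC divfK// !ge_min lexx orbT.
  have -> : circle_int f x - circle_int f y = - (circle_int f (x + d) - circle_int f x) +
      (circle_int f (y - d) - circle_int f y).
    rewrite (@circle_int_annulus f (x + d) (y - d)); [ring|lra|lra|].
    move=> z /andP[hz1 hz2]; apply: hd; first lra.
    apply/negP => zS; have := hs _ zS.
    have -> : x < nm z < y by apply/andP; split; lra.
    by move=> /(_ isT).
  apply: le_trans (le_nmD _ _) _; rewrite nmN.
  have k1 : nm (circle_int f (x + d) - circle_int f x) <= e / 2.
    apply: h1; first by apply/andP; split; lra.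
    by rewrite addrC addKr gtr0_norm; lra.
  have k2 : nm (circle_int f (y - d) - circle_int f y) <= e / 2.
    apply: h2; first by apply/andP; split; lra.
    by rewrite addrC addKr normrN gtr0_norm; lra.
  lra.
have [/andP[xa ay]|ha] := boolP (x < nm a < y); last first.
  apply: ih => //; first exact: ltW.
  move=> b bS hb; have := hs b bS hb; rewrite inE => /orP[/eqP ba|//].
  by rewrite ba in hb; rewrite hb in ha.
rewrite (ih x (nm a))//; last 3 first.
- exact: ltW.
- exact: le_trans (ltW ay) yr.
- move=> b bS /andP[xb ba]; have := hs b bS; rewrite xb (lt_trans ba ay) => /(_ isT).
  by rewrite inE => /orP[/eqP bb|//]; rewrite bb ltxx in ba.
apply: ih => //; [exact: lt_trans xa|exact: ltW|].
move=> b bS /andP[ab yb]; have := hs b bS; rewrite yb (lt_trans xa ab) => /(_ isT).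
by rewrite inE => /orP[/eqP bb|//]; rewrite bb ltxx in ab.
Qed.

(* The finite exceptional set S carries only continuity: crossing the circle
   through an exceptional point does not change the integral. *)
Theorem circle_mean (S : seq R[i]) f rho : 0 < rho -> (forall z, nm z <= rho -> ccont f z) ->
  (forall z, nm z < rho -> z \notin S -> cdiff f z) ->
  circle_int f rho = (2 * pi)%:C * f 0.
Proof.
move=> r0 hc hd.
have -> : (2 * pi)%:C * f 0 = circle_int f 0.
  rewrite /circle_int (eq_cint (H := fun=> f 0)); last by move=> t _; rewrite mul0r.
  by rewrite cint_cst ?pi2_ge0// subr0.
apply: eq_of_nm_le => e e0.
have [|d d0 h] := circle_int_cont hc _ e0 (x := 0); first by rewrite lexx ltW.
pose y := Num.min (d / 2) rho.
have y0 : 0 < y by rewrite lt_min r0 divr_gt0.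
have yr : y <= rho by rewrite ge_min lexx orbT.
rewrite -(circle_int_const hc hd (s := S) y0 yr (lexx _)); last by [].
apply: h; first by rewrite ltW.
by rewrite subr0 gtr0_norm// (le_lt_trans (y := d / 2))// ?ge_min ?lexx//; lra.
Qed.

End MeanValue.

(** * Cauchy's formula and removable singularities *)

Section CauchyFormula.
Variable R : realType.
Implicit Types (f g h : R[i] -> R[i]) (z w a : R[i]) (t : R).

Lemma exists_arg z : exists2 t : R, 0 <= t < 2 * pi & z = (nm z)%:C * expi t.
Proof.
have pi0 := @pi_gt0 R.
have [->|z0] := eqVneq z 0.
  by exists 0; [rewrite lexx/= mulr_gt0|rewrite nm0 mul0r].
have n0 : 0 < nm z by rewrite nm_gt0.
have n0' : nm z != 0 by rewrite lt0r_neq0.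
pose x := complex.Re z / nm z; pose y := complex.Im z / nm z.
have xy : x ^+ 2 + y ^+ 2 = 1.
  rewrite /x /y !expr_div_n -mulrDl -nm_sqr divff// expf_neq0//.
have x1 : -1 <= x <= 1.
  by rewrite -ler_norml -(ler_pXn2r (n := 2)) ?nnegrE// real_normK ?num_real// expr1n -xy lerDl sqr_ge0.
have ca : cos (acos x) = x by apply: acosK; rewrite in_itv.
have a0 := acos_ge0 x1; have api := acos_lepi x1.
have zE t : cos t = x -> sin t = y -> z = (nm z)%:C * expi t.
  move=> ct st; rewrite /expi ct st /x /y; apply/eqP; rewrite eq_complex /= !mul0r subr0 addr0.
  by rewrite ![nm z * _]mulrC !divfK// !eqxx.
have sa : sin (acos x) = `|y|.
  by rewrite sin_acos// -xy addrAC subrr add0r sqrtr_sqr.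
have [y0|y0] := leP 0 y.
  exists (acos x); first by apply/andP; split; lra.
  apply: zE; first exact: ca.
  by rewrite sa ger0_norm.
exists (2 * pi - acos x).
  apply/andP; split; first lra.
  (* A negative y excludes the angle 0, which keeps 2 pi - acos x below 2 pi. *)
  have : acos x != 0.
    apply: contraTneq y0 => h0; rewrite -leNgt.
    have /eqP : `|y| = 0 by rewrite -sa h0 sin0.
    by rewrite normr_eq0 => /eqP ->.
  by move=> an0; have : 0 < acos x; [rewrite lt_neqAle eq_sym an0|lra].
have e2 : 2 * pi - acos x = (- acos x) + pi *+ 2
  by rewrite -(mulr_natl pi 2) addrC.
apply: zE; rewrite e2.
  by rewrite cosD2pi cosN.
by rewrite sinD2pi sinN sa ltr0_norm// opprK.
Qed.

Lemma circle_bounded f rho : 0 <= rho -> (forall z, nm z = rho -> ccont f z) ->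
  exists M : R, forall z, nm z = rho -> nm (f z) <= M.
Proof.
move=> r0 hf.
have : {within `[0, 2 * pi], continuous (fun t => nm (f (rho%:C * expi t)))}.
  apply: continuous_in_subspaceT => t _; apply/rcontP/pcont_nm/pcont_on_circle/hf.
  by rewrite nm_circle.
move/(EVT_max (pi2_ge0 R)) => [c _ hM]; exists (nm (f (rho%:C * expi c))) => z hz.
have [t /andP[t0 t1] ->] := exists_arg z; rewrite hz; apply: hM.
by rewrite in_itv /= t0 ltW.
Qed.

(** The kernel has its pole inside the circle, but on the circle w conj(w) = rho^2 turns its
    conjugate into rho^2 / (rho^2 - conj(z) w). This is holomorphic on the closed disc with value 1
    at 0, so the mean value property applies. *)
Lemma circle_int_kernel z (rho : R) : nm z < rho ->
  circle_int (fun w => w / (w - z)) rho = (2 * pi)%:C.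
Proof.
move=> zr; have r0 : 0 < rho := le_lt_trans (nm_ge0 z) zr.
have rC : rho%:C != 0 :> R[i] by rewrite -nm_gt0 nm_pos// ltW.
pose k w := (rho%:C ^+ 2) / (rho%:C ^+ 2 - z^* * w).
have kne w : nm w <= rho -> rho%:C ^+ 2 - z^* * w != 0.
  move=> wr; rewrite -nm_gt0; apply: lt_le_trans (le_nmB _ _).
  rewrite nmX nm_pos ?(ltW r0)// nmM nm_conj subr_gt0 expr2.
  by apply: le_lt_trans (ler_wpM2l (nm_ge0 _) wr) _; rewrite ltr_pM2r.
have kd w : nm w <= rho -> cdiff k w.
  move=> wr; apply: cdiffM; first exact: cdiff_cst.
  apply: cdiffV; first exact: kne.
  apply: cdiffB; first exact: cdiff_cst.
  by apply: cdiffM; [exact: cdiff_cst|exact: cdiff_id].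
have : circle_int k rho = (2 * pi)%:C.
  rewrite (@circle_mean R [::])//; first by rewrite /k mulr0 subr0 divff ?mulr1// expf_neq0.
    by move=> w /kd/cdiff_ccont.
  by move=> w /ltW /kd.
move/(congr1 (fun u : R[i] => u^*)); rewrite conjc_real /circle_int -cint_conj; last first.
  by move=> t _; apply: pcont_on_circle; apply/cdiff_ccont/kd; rewrite nm_circle// ltW.
move=> <-; apply: eq_cint => t _; rewrite /k; set w := rho%:C * expi t.
have hw : rho%:C ^+ 2 = w * w^*.
  by rewrite mul_conjc nm_circle ?ltW// rmorphXn.
have w0 : w != 0 by rewrite -nm_gt0 nm_circle// ltW.
have wz : w - z != 0.
  by rewrite -nm_gt0; apply: lt_le_trans (le_nmB _ _); rewrite nm_circle ?ltW// subr_gt0.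
clearbody w; rewrite hw rmorphM fmorphV rmorphB !rmorphM /= !conjcK.
have wc0 : w^* != 0 by rewrite conjc_eq0.
by field; rewrite wz andbT [z * _]mulrC -mulrBr mulf_neq0.
Qed.

Lemma ccont_ratio f z w : ccont f w -> w != z -> ccont (fun u => f u / (u - z)) w.
Proof.
move=> hf wz; apply: ccontM => //; apply: ccontV; first by rewrite subr_eq0.
by apply: ccontB; [exact: ccont_id|exact: ccont_cst].
Qed.

Lemma cdiff_ratio f z w : cdiff f w -> w != z -> cdiff (fun u => f u / (u - z)) w.
Proof.
move=> hf wz; apply: cdiffM => //; apply: cdiffV; first by rewrite subr_eq0.
by apply: cdiffB; [exact: cdiff_id|exact: cdiff_cst].
Qed.

Lemma neq_local z w : w != z -> exists2 d : R, 0 < d & forall u, nm (u - w) < d -> u != z.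
Proof.
move=> wz; exists (nm (w - z)); first by rewrite nm_gt0 subr_eq0.
by move=> u hu; apply/eqP => uz; rewrite uz nm_sub ltxx in hu.
Qed.

Lemma slope_local f q z w : (forall u, f u = f z + q u * (u - z)) -> w != z ->
  clocal q (fun u => (f u - f z) / (u - z)) w.
Proof.
move=> hq wz; have [d d0 hd] := neq_local wz; exists d => // u /hd uz.
by rewrite (hq u) addrAC subrr add0r mulfK// subr_eq0.
Qed.

(** With q the slope of f at z, f(w) w / (w - z) = w q(w) + f(z) w / (w - z). The function w q(w)
    vanishes at 0, hence has integral zero; z joins the exceptional points because q is only known
    to be continuous there. *)
Theorem cauchy_formula (S : seq R[i]) f (rho : R) z : nm z < rho ->
  (forall w, nm w <= rho -> ccont f w) ->
  (forall w, nm w < rho -> w \notin S -> cdiff f w) -> cdiff f z ->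
  circle_int (fun w => f w * (w / (w - z))) rho = (2 * pi)%:C * f z.
Proof.
move=> zr hc hd [q qz hq]; have r0 : 0 < rho := le_lt_trans (nm_ge0 z) zr.
have E : circle_int (fun w => w * q w) rho = 0.
  rewrite (@circle_mean R (z :: S))//; first by rewrite mul0r mulr0.
    move=> w wr; apply: ccontM; first exact: ccont_id.
    have [->//|wz] := eqVneq w z; apply: (ccont_local (slope_local hq wz)).
    by apply: ccont_ratio => //; apply: ccontB; [exact: hc|exact: ccont_cst].
  move=> w wr; rewrite inE negb_or => /andP[wz wS]; apply: cdiffM; first exact: cdiff_id.
  apply: (cdiff_local (slope_local hq wz)).
  by apply: cdiff_ratio => //; apply: cdiffB; [exact: hd|exact: cdiff_cst].
have wz t : rho%:C * expi t != z.
  by apply/eqP => h; rewrite -h nm_circle ?ltxx// ltW in zr.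
have ck t : pcont (fun t => (rho%:C * expi t) / (rho%:C * expi t - z)) t.
  by apply: (pcont_on_circle (f := fun w => w / (w - z))); apply: (ccont_ratio (f := id)) => //; exact: ccont_id.
have cq t : pcont (fun t => (rho%:C * expi t) * q (rho%:C * expi t)) t.
  apply: (pcont_on_circle (f := fun w => w * q w)); apply: ccontM; first exact: ccont_id.
  apply: (ccont_local (slope_local hq (wz t))); apply: ccont_ratio => //.
  by apply: ccontB; [apply: hc; rewrite nm_circle// ltW|exact: ccont_cst].
rewrite -(circle_int_kernel zr) mulrC /circle_int -cintZ// -[RHS]add0r -E /circle_int -cintD//.
  apply: eq_cint => t _; have := wz t; set w := _ * expi t => wz'.
  by rewrite (hq w); field; rewrite subr_eq0.
by move=> t _; apply: pcontZ.
Qed.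

(** A maximum principle up to the factor rho / (rho - |z|), which equals 1 at the centre and is
    otherwise absorbed by a geometric decay. *)
Lemma cauchy_bound f (rho M : R) z : nm z < rho ->
  (forall w, nm w <= rho -> cdiff f w) ->
  (forall w, nm w = rho -> nm (f w) <= M) -> nm (f z) <= M * (rho / (rho - nm z)).
Proof.
move=> zr hd hM; have r0 : 0 < rho := le_lt_trans (nm_ge0 z) zr.
have pi0 : 0 < 2 * pi :> R by rewrite mulr_gt0// pi_gt0.
have wz t : rho%:C * expi t != z.
  by apply/eqP => h; rewrite -h nm_circle ?ltxx// ltW in zr.
have hf := @cauchy_formula [::] f rho z zr (fun w hw => cdiff_ccont (hd w hw))
  (fun w hw _ => hd w (ltW hw)) (hd z (ltW zr)).
rewrite -(ler_pM2l pi0) -[X in X * nm _]nm_pos ?(ltW pi0)// -nmM -hf /circle_int.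
rewrite -[X in _ <= X * _]subr0; apply: cint_le; first exact: pi2_ge0.
  move=> t _; apply: (pcont_on_circle (f := fun w => f w * (w / (w - z)))).
  apply: ccontM; first by apply/cdiff_ccont/hd; rewrite nm_circle// ltW.
  by apply: (ccont_ratio (f := id)) => //; exact: ccont_id.
move=> t _; have := wz t; have : nm (rho%:C * expi t) = rho by rewrite nm_circle// ltW.
set w := _ * expi t => nw wz'; clearbody w.
rewrite !nmM nmV nw; apply: ler_pM; rewrite ?nm_ge0//.
- by rewrite divr_ge0 ?nm_ge0// ltW.
- exact: hM.
rewrite ler_pM2l// lef_pV2 ?posrE ?subr_gt0//; last by rewrite nm_gt0 subr_eq0.
by rewrite -nw le_nmB.
Qed.

Lemma eq_of_ccont f g a : ccont f a -> ccont g a ->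
  (exists2 d : R, 0 < d & forall w, w != a -> nm (w - a) < d -> f w = g w) -> f a = g a.
Proof.
move=> hf hg [d d0 h]; apply: eq_of_nm_le => e e0; have e2 : 0 < e / 2 by rewrite divr_gt0.
have [d1 d10 h1] := hf _ e2; have [d2 d20 h2] := hg _ e2.
pose x := Num.min d (Num.min d1 d2) / 2.
have x0 : 0 < x by rewrite divr_gt0// !lt_min d0 d10 d20.
have xd : 2 * x <= d by rewrite /x mulrC divfK// !ge_min lexx.
have xd1 : 2 * x <= d1 by rewrite /x mulrC divfK// !ge_min lexx ?orbT.
have xd2 : 2 * x <= d2 by rewrite /x mulrC divfK// !ge_min lexx ?orbT.
pose w := a + x%:C.
have nw : nm (w - a) = x by rewrite /w addrC addKr nm_pos// ltW.
have wa : w != a by rewrite -subr_eq0 -nm_gt0 nw.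
have k1 := h1 w ltac:(lra); have k2 := h2 w ltac:(lra).
have k3 := h w wa ltac:(lra).
rewrite (_ : f a - g a = - (f w - f a) + (g w - g a)); last by rewrite k3; ring.
by apply: le_trans (le_nmD _ _) _; rewrite nmN; lra.
Qed.

(** Subtracting the derivative b of the kernel leaves exactly (z - a)^2 times the integral of f(w) w
    / ((w - z) (w - a)^2). That integral is bounded by K as long as z stays within dl, half the
    distance of a to the circle. *)
Lemma cauchy_integral_cdiff f (rho : R) a : nm a < rho ->
  (forall w, nm w = rho -> ccont f w) ->
  cdiff (fun z => circle_int (fun w => f w * (w / (w - z))) rho) a.
Proof.
move=> ar hf; have r0 : 0 < rho := le_lt_trans (nm_ge0 a) ar.
have [M hM] := circle_bounded (ltW r0) hf.
have nr t : nm (rho%:C * expi t) = rho by rewrite nm_circle// ltW.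
have M0 : 0 <= M by apply: le_trans (hM (rho%:C * expi 0) (nr 0)); exact: nm_ge0.
pose dl := (rho - nm a) / 2.
have dl0 : 0 < dl by rewrite divr_gt0// subr_gt0.
have wz z t : nm (z - a) < dl -> dl <= nm (rho%:C * expi t - z).
  move=> h; have := le_nmB (rho%:C * expi t) z; rewrite nr.
  by have := le_nmB z a; move: h; rewrite /dl; lra.
have wz0 z t : nm (z - a) < dl -> rho%:C * expi t - z != 0.
  by move=> /(wz _ t); rewrite -nm_gt0; apply: lt_le_trans.
have aa : nm (a - a) < dl by rewrite subrr nm0.
have pc z t : nm (z - a) < dl -> pcont (fun t => f (rho%:C * expi t) * (rho%:C * expi t / (rho%:C * expi t - z))) t.
  move=> hz; apply: (pcont_on_circle (f := fun w => f w * (w / (w - z)))).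
  apply: ccontM; first exact: hf.
  by apply: (ccont_ratio (f := id)); [exact: ccont_id|rewrite -subr_eq0 wz0].
have pb t : pcont (fun t => f (rho%:C * expi t) * (rho%:C * expi t / (rho%:C * expi t - a) ^+ 2)) t.
  apply: (pcont_on_circle (f := fun w => f w * (w / (w - a) ^+ 2))).
  apply: ccontM; first exact: hf.
  apply: ccontM; first exact: ccont_id.
  apply: ccontV; first by rewrite expf_neq0// wz0.
  by apply: ccontM; apply: ccontB; (exact: ccont_id || exact: ccont_cst).
pose b := circle_int (fun w => f w * (w / (w - a) ^+ 2)) rho.
pose K := (2 * pi - 0) * (M * (rho / dl ^+ 3)).
have K0 : 0 <= K by rewrite /K subr0 mulr_ge0 ?pi2_ge0// mulr_ge0// divr_ge0 ?(ltW r0)// exprn_ge0// ltW.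
apply: (cdiffP (b := b)) => e e0.
exists (Num.min dl (e / (K + 1))); first by rewrite lt_min dl0 divr_gt0//; lra.
move=> z; rewrite lt_min => /andP[zd ze].
have -> : circle_int (fun w => f w * (w / (w - z))) rho - circle_int (fun w => f w * (w / (w - a))) rho - b * (z - a) =
   (z - a) ^+ 2 * circle_int (fun w => f w * (w / ((w - z) * (w - a) ^+ 2))) rho.
  rewrite [b * _]mulrC /b /circle_int -!cintZ//; last first.
    move=> t _; apply: (pcont_on_circle (f := fun w => f w * (w / ((w - z) * (w - a) ^+ 2)))).
    apply: ccontM; first exact: hf.
    apply: ccontM; first exact: ccont_id.
    apply: ccontV; first by rewrite mulf_neq0 ?expf_neq0// wz0.
    apply: ccontM; first by apply: ccontB; [exact: ccont_id|exact: ccont_cst].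
    by apply: ccontM; apply: ccontB; (exact: ccont_id || exact: ccont_cst).
  rewrite -!cintB; try by move=> t _; auto.
  - apply: eq_cint => t _; have := wz0 z t zd; have := wz0 a t aa.
    by set w := _ * expi t => h1 h2; clearbody w; field; rewrite h1 h2.
  - by move=> t _; apply: pcontB; auto.
  - by move=> t _; apply: pcontZ.
have bd : nm (circle_int (fun w => f w * (w / ((w - z) * (w - a) ^+ 2))) rho) <= K.
  apply: cint_le; first exact: pi2_ge0.
    move=> t _; apply: (pcont_on_circle (f := fun w => f w * (w / ((w - z) * (w - a) ^+ 2)))).
    apply: ccontM; first exact: hf.
    apply: ccontM; first exact: ccont_id.
    apply: ccontV; first by rewrite mulf_neq0 ?expf_neq0// wz0.
    apply: ccontM; first by apply: ccontB; [exact: ccont_id|exact: ccont_cst].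
    by apply: ccontM; apply: ccontB; (exact: ccont_id || exact: ccont_cst).
  move=> t _; have := wz z t zd; have := wz a t aa; have := hM _ (nr t); have := nr t.
  set w := _ * expi t => nw hw h1 h2; clearbody w.
  have nz0 : 0 < nm (w - z) by exact: lt_le_trans h2.
  have na0 : 0 < nm (w - a) by exact: lt_le_trans h1.
  rewrite 2!nmM nmV nw nmM nmX; apply: ler_pM; rewrite ?nm_ge0//.
    by rewrite divr_ge0 ?(ltW r0)// mulr_ge0 ?exprn_ge0// ltW.
  have p0 : 0 < nm (w - z) * nm (w - a) ^+ 2 by rewrite mulr_gt0// exprn_gt0.
  rewrite ler_pM2l// lef_pV2 ?posrE ?p0 ?(exprn_gt0 3 dl0)//.
  rewrite exprS.
  apply: ler_pM; rewrite ?exprn_ge0 ?(ltW dl0)//.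
  by rewrite ler_pXn2r ?nnegrE ?(ltW dl0) ?(ltW na0).
rewrite nmM nmX expr2 -mulrA [e * _]mulrC ler_wpM2l ?nm_ge0//.
apply: le_trans (ler_wpM2l (nm_ge0 _) bd) _.
have : nm (z - a) * (K + 1) <= e by rewrite -ler_pdivlMr ?ltW//; lra.
by have := nm_ge0 (z - a); lra.
Qed.

(** Cauchy's formula tolerates a as an exceptional point, so f agrees away from a with a Cauchy
    integral that is differentiable at a; continuity settles the value at a. *)
Lemma removable f (rho : R) a : nm a < rho -> (forall w, nm w < rho -> ccont f w) ->
  (forall w, nm w < rho -> w != a -> cdiff f w) -> cdiff f a.
Proof.
move=> ar0 hc0 hd0; pose r := (nm a + rho) / 2.
have ar : nm a < r by rewrite /r; lra.
have rr : r < rho by rewrite /r; lra.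
have hc w : nm w <= r -> ccont f w by move=> h; apply: hc0; apply: le_lt_trans rr.
pose L z := ((2 * pi)%:C)^-1 * circle_int (fun w => f w * (w / (w - z))) r.
have pi0 : (2 * pi)%:C != 0 :> R[i].
  by rewrite -nm_gt0 nm_pos ?pi2_ge0// mulr_gt0// pi_gt0.
have LE z : nm z < r -> z != a -> f z = L z.
  move=> zr za; rewrite /L (@cauchy_formula [:: a])//.
  - by rewrite mulKf.
  - by move=> w wr; rewrite inE => wa; apply: hd0 => //; apply: lt_trans wr rr.
  - by apply: hd0 => //; apply: lt_trans zr rr.
have Ld : cdiff L a.
  apply: cdiffM; first exact: cdiff_cst.
  by apply: cauchy_integral_cdiff => // w wr; apply: hc; rewrite wr.
have near d w : nm (w - a) < d -> d <= r - nm a -> nm w < r.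
  by move=> h1 h2; have := le_nmB w a; lra.
have r1 : 0 < r - nm a by rewrite subr_gt0.
have La : f a = L a.
  apply: eq_of_ccont; [by apply: hc; exact: ltW|exact: cdiff_ccont|].
  by exists (r - nm a) => // w wa h; apply: LE => //; exact: near h (lexx _).
apply: (cdiff_local (g := L)) => //; exists (r - nm a) => // w h.
by have [->//|wa] := eqVneq w a; apply: LE => //; exact: near h (lexx _).
Qed.

Definition holo f := forall z, nm z < 1 -> cdiff f z.

(** The quotient is the slope of f at a: it is continuous at a by definition, so a is a removable
    singularity. *)
Lemma holo_divide f a : holo f -> nm a < 1 -> f a = 0 ->
  exists2 h, holo h & forall z, f z = (z - a) * h z.
Proof.
move=> hf a1 fa; have [q qa hq] := hf a a1; exists q; last first.
  by move=> z; rewrite (hq z) fa add0r mulrC.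
have qd w : nm w < 1 -> w != a -> cdiff q w.
  move=> w1 wa; apply: (cdiff_local (slope_local hq wa)); apply: cdiff_ratio => //.
  by apply: cdiffB; [exact: hf|exact: cdiff_cst].
move=> w w1; have [->|wa] := eqVneq w a; last exact: qd.
apply: (removable a1) => // u u1; have [->//|ua] := eqVneq u a.
by apply/cdiff_ccont/qd.
Qed.

End CauchyFormula.

(** * Splitting off zeros, and the identity theorem *)

Section Zeros.
Variable R : realType.
Implicit Types (f g h : R[i] -> R[i]) (z w a : R[i]).

(** The list may repeat points, so zeros count with multiplicity without any notion of order; h may
    have further zeros. *)
Definition has_zeros f (r : R) n := exists (s : seq R[i]) h,
  [/\ size s = n, {in s, forall a, nm a <= r}, holo h &
   forall z, nm z < 1 -> f z = (\prod_(a <- s) (z - a)) * h z].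

Lemma has_zeros0 f r : holo f -> has_zeros f r 0.
Proof. by move=> hf; exists [::], f; split => // z _; rewrite big_nil mul1r. Qed.

Lemma has_zeros_cons f h r a n : nm a <= r -> (forall z, nm z < 1 -> f z = (z - a) * h z) ->
  has_zeros h r n -> has_zeros f r n.+1.
Proof.
move=> ar fh [s [k [sn hs hk kE]]]; exists (a :: s), k; split => //=.
- by rewrite sn.
- by move=> b; rewrite inE => /orP[/eqP->//|/hs].
- by move=> z z1; rewrite fh// kE// big_cons mulrA.
Qed.

Lemma geometric_le0 (x K q : R) : 0 <= q < 1 -> (forall n, x <= K * q ^+ n) -> x <= 0.
Proof.
move=> /andP[q0 q1] h; rewrite leNgt; apply/negP => x0.
have K0 : 0 < K.
  by have := h 0%N; rewrite expr0 mulr1; exact: lt_le_trans.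
have q1' : `|q| < 1 by rewrite ger0_norm.
have e0 : 0 < x / (2 * K) by rewrite divr_gt0// mulr_gt0.
have /cvgrPdist_lt/(_ _ e0) [N _ hN] := cvg_expr q1'.
have := hN N (leqnn N); rewrite sub0r normrN ger0_norm ?exprn_ge0//.
rewrite ltr_pdivlMr ?mulr_gt0//; have := h N; lra.
Qed.

(** This compares numerator and denominator of the Blaschke factor of |z| < rho: equal moduli on the
    circle, and a definite gap inside. *)
Lemma blaschke_identity (rho : R) a z :
  nm ((rho ^+ 2)%:C - a^* * z) ^+ 2 - rho ^+ 2 * nm (z - a) ^+ 2 =
  (rho ^+ 2 - nm a ^+ 2) * (rho ^+ 2 - nm z ^+ 2).
Proof. by rewrite !nm_sqr; case: a => a1 a2; case: z => z1 z2 /=; ring. Qed.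

Lemma blaschke_circle (rho : R) a z : 0 <= rho -> nm z = rho ->
  nm ((rho ^+ 2)%:C - a^* * z) = rho * nm (z - a).
Proof.
move=> r0 hz; apply/eqP; rewrite -(eqrXn2 (n := 2)) ?mulr_ge0 ?nm_ge0//.
by rewrite exprMn -subr_eq0 blaschke_identity hz subrr mulr0.
Qed.

(** Replacing each z - a by (rho^2 - conj(a) z) / rho keeps the modulus on |z| = rho, so the
    resulting [H] is bounded by M there and by a constant at z, whatever n is. At z each replacement
    gains a factor q < 1 in the squared modulus, hence |f(z)|^2 <= K q^n. *)
Theorem zeros_bounded f (r : R) : 0 <= r < 1 -> holo f -> (forall n, has_zeros f r n) ->
  forall z, nm z < 1 -> f z = 0.
Proof.
move=> /andP[r0 r1] hf hn z z1.
pose r' := Num.max r (nm z).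
have r'1 : r' < 1 by rewrite gt_max r1.
have rr' : r <= r' by rewrite le_max lexx.
have zr' : nm z <= r' by rewrite le_max lexx orbT.
pose rho := (1 + r') / 2.
have r'0 := le_trans r0 rr'.
have r'rho : r' < rho by rewrite /rho; lra.
have rho1 : rho < 1 by rewrite /rho; lra.
have rho0 : 0 < rho by apply: le_lt_trans r'rho.
have [M hM] := @circle_bounded _ f rho (ltW rho0) (fun w hw => cdiff_ccont (hf w ltac:(lra))).
pose c := (rho ^+ 2 - r' ^+ 2) ^+ 2.
have c00 : 0 < rho ^+ 2 - r' ^+ 2 by rewrite subr_gt0 ltr_pXn2r// nnegrE// ltW.
have c0 : 0 < c by rewrite exprn_gt0.
have c1 : c <= 1.
  rewrite exprn_ile1// ?(ltW c00)//; have := sqr_ge0 r'.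
  have : rho ^+ 2 <= 1 by rewrite exprn_ile1// ltW.
  lra.
(* By [blaschke_identity] the gap is at least c, and the denominator satisfies |D|^2 <= 4, so the
   gap is at least (c / 4) |D|^2. *)
pose q := 1 - c / 4.
have q01 : 0 <= q < 1 by rewrite /q; lra.
pose D a w := (rho ^+ 2)%:C - a^* * w.
have Db a : nm a <= r -> rho ^+ 2 * nm (z - a) ^+ 2 <= q * nm (D a z) ^+ 2.
  move=> ar; have ar' := le_trans ar rr'.
  have e1 := blaschke_identity rho a z.
  have : c <= (rho ^+ 2 - nm a ^+ 2) * (rho ^+ 2 - nm z ^+ 2).
    rewrite /c expr2; apply: ler_pM; rewrite ?(ltW c00)// lerD2l lerN2 ler_pXn2r ?nnegrE ?nm_ge0//.
  have D2 : nm (D a z) <= 2.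
    apply: le_trans (le_nmD _ _) _; rewrite nmN nm_pos ?sqr_ge0// nmM nm_conj.
    have : nm a * nm z <= 1 * 1 by rewrite ler_pM ?nm_ge0// ltW// (le_lt_trans ar').
    have : rho ^+ 2 <= 1 by rewrite exprn_ile1// ltW.
    lra.
  have D4 : nm (D a z) ^+ 2 <= 2 ^+ 2 by rewrite ler_pXn2r ?nnegrE ?nm_ge0.
  have : c * nm (D a z) ^+ 2 <= c * 2 ^+ 2 by rewrite ler_wpM2l// ltW.
  rewrite /q -/(D a z) in e1 *; rewrite /D in e1 *; lra.
pose K := (M * (rho / (rho - nm z))) ^+ 2.
apply: nm0_eq0; apply/eqP; rewrite -sqrf_eq0 eq_le sqr_ge0 andbT.
apply: (geometric_le0 (K := K) q01) => n.
have [s [h [sn hs hh fE]]] := hn n.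
pose H w := h w * \prod_(a <- s) (rho^-1%:C * D a w).
have Hd w : nm w <= rho -> cdiff H w.
  move=> wr; apply: cdiffM; first by apply: hh; exact: le_lt_trans rho1.
  apply: cdiff_prod => a _; apply: cdiffM; first exact: cdiff_cst.
  apply: cdiffB; first exact: cdiff_cst.
  by apply: cdiffM; [exact: cdiff_cst|exact: cdiff_id].
have HM w : nm w = rho -> nm (H w) <= M.
  move=> wr; have := hM w wr; rewrite fE ?wr// /H !nmM mulrC !nm_prod.
  suff -> : \prod_(a <- s) nm (rho^-1%:C * D a w) = \prod_(a <- s) nm (w - a) by [].
  apply: eq_bigr => a _; rewrite nmM blaschke_circle ?(ltW rho0)// nm_pos ?invr_ge0 ?(ltW rho0)//.
  by rewrite mulKf// lt0r_neq0.
have zrho : nm z < rho by exact: le_lt_trans r'rho.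
have Hz := cauchy_bound zrho Hd HM.
have : nm (f z) ^+ 2 <= nm (H z) ^+ 2 * q ^+ n.
  rewrite fE// /H !nmM !nm_prod !exprMn [leLHS]mulrC -[leRHS]mulrA ler_wpM2l ?sqr_ge0//.
  rewrite -sn; elim: {sn fE H Hd HM Hz} s hs => [|a s ih] hs.
    by rewrite !big_nil expr1n mulr1.
  rewrite !big_cons /= [q ^+ _]exprS !exprMn [leRHS]mulrACA; apply: ler_pM; rewrite ?sqr_ge0//; last first.
    by apply: ih => b bs; apply: hs; rewrite inE bs orbT.
  have hD := Db a (hs a (mem_head a s)).
  rewrite nmM nm_pos ?invr_ge0 ?(ltW rho0)//.
  have -> : (rho^-1 * nm (D a z)) ^+ 2 * q = q * nm (D a z) ^+ 2 / rho ^+ 2.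
    by field; rewrite lt0r_neq0.
  by rewrite ler_pdivlMr ?exprn_gt0// mulrC.
move=> hfH; apply: le_trans hfH _; rewrite ler_wpM2r ?exprn_ge0//; first by have /andP[] := q01.
rewrite ler_pXn2r ?nnegrE ?nm_ge0//; exact: le_trans (nm_ge0 _) Hz.
Qed.

(** No accumulation point is taken: dividing by the zeros in X one after the other gives n factors
    for every n, each quotient still vanishing on X without the points used. *)
Theorem holo_identity f (r : R) (X : set R[i]) : 0 <= r < 1 -> holo f -> infinite_set X ->
  (forall z, X z -> nm z <= r /\ f z = 0) -> forall z, nm z < 1 -> f z = 0.
Proof.
move=> r01 hf iX hX; apply: (zeros_bounded r01 hf) => n.
elim: n f X hf iX hX => [|n ih] f X hf iX hX; first exact: has_zeros0.
have [a Xa] : X !=set0.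
  by apply/set0P/eqP => X0; apply: iX; rewrite X0; exact: finite_set0.
have [ar fa] := hX a Xa; have /andP[r0 r1] := r01.
have [h hh fE] := holo_divide hf (le_lt_trans ar r1) fa.
apply: (has_zeros_cons ar (h := h)) => //.
apply: (ih h (X `\ a)) => //.
  move=> fX; apply: iX; apply: (@sub_finite_set _ _ ((X `\ a) `|` [set a])).
    by move=> x Xx; have [->|xa] := eqVneq x a; [right|left; split => //; apply/eqP].
  by rewrite finite_setU; split => //; exact: finite_set1.
move=> z [Xz /eqP za]; have [zr fz] := hX z Xz; split => //.
move/eqP: fz; rewrite fE mulf_eq0 subr_eq0 => /orP[/eqP zea|/eqP//].
by rewrite zea eqxx in za.
Qed.

End Zeros.

(** * Infinite sets of angles and of circle points *)

Section InfiniteSets.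
Variable R : realType.

Lemma infinite_of_injection (T : Type) (A : set T) (u : nat -> T) :
  injective u -> (forall n, A (u n)) -> infinite_set A.
Proof.
move=> ui uA fA; apply: infinite_nat; apply: (@sub_finite_set _ _ (u @^-1` A)).
  by move=> n _; exact: uA.
by apply: finite_preimage => // x y _ _; exact: ui.
Qed.

Lemma infinite_itv (a b : R) : a < b -> infinite_set [set t : R | a < t < b].
Proof.
move=> ab; apply: (infinite_of_injection (u := fun n => a + (b - a) / n.+2%:R)).
  have ba : b - a != 0 by rewrite subr_eq0 gt_eqF.
  by move=> n m /addrI /(mulfI ba) /invr_inj /eqP; rewrite eqr_nat => /eqP [].
move=> n /=; rewrite ltrDl divr_gt0 ?subr_gt0//= -ltrBrDl ltr_pdivrMr//.
by rewrite ltr_pMr ?subr_gt0// ltr1n.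
Qed.

(** Half the difference lies strictly between -pi and pi, and cos 2x = 1 means sin x = 0, which
    leaves only x = 0. *)
Lemma expi_inj (s t : R) : 0 <= s < 2 * pi -> 0 <= t < 2 * pi -> expi s = expi t -> s = t.
Proof.
have pi0 := @pi_gt0 R.
move=> hs ht est; apply/eqP; rewrite -subr_eq0.
have e1 : expi (s - t) = 1 :> R[i].
  by rewrite expiD expiN est mul_conjc nm_expi expr1n.
have c1 : cos (s - t) = 1 by move/(congr1 (@complex.Re R)): e1.
pose x := (s - t) / 2.
have x2 : s - t = x *+ 2 by rewrite /x -mulr_natr divfK.
have sx : sin x = 0.
  apply/eqP; rewrite -sqrf_eq0; move: c1; rewrite x2 cos_mulr2n cos2sin2; move=> h; apply/eqP; lra.
have [x0|x0|x0] := ltgtP x 0; last by rewrite x2 x0 mul0rn.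
  have : 0 < sin (- x) by apply: sin_gt0_pi; rewrite /x; lra.
  by rewrite sinN sx oppr0 ltxx.
have : 0 < sin x by apply: sin_gt0_pi; rewrite /x in x0 *; lra.
by rewrite sx ltxx.
Qed.

Lemma infinite_image (T U : Type) (A : set T) (u : T -> U) :
  infinite_set A -> (forall x y, A x -> A y -> u x = u y -> x = y) -> infinite_set (u @` A).
Proof.
move=> iA ui fA; apply: iA; rewrite -(eq_finite_set (inj_card_eq (f := u) _))//.
by move=> x y; rewrite !inE; exact: ui.
Qed.

Lemma infinite_circle (r : R) (T : set R) : 0 < r -> infinite_set T ->
  T `<=` [set t | 0 <= t < 2 * pi] -> infinite_set [set r%:C * expi t | t in T].
Proof.
move=> r0 iT hT; apply: infinite_image => // x y /hT hx /hT hy /mulfI h; apply: expi_inj => //.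
by apply: h; rewrite -nm_gt0 nm_pos// ltW.
Qed.

End InfiniteSets.

(** * Propagation of equal moduli along a circle *)

Section CircleIdentity.
Variable R : realType.
Implicit Types (f g : R[i] -> R[i]) (z w : R[i]) (t : R).

(** The holomorphic extension of t -> |f(r e^(it))|^2 from the real line to the strip |Im w| < - ln
    r. *)
Definition strip f (r : R) w :=
  (f (r%:C * cexp ('i%C * w)) * (f (r%:C * cexp ('i%C * w^*%C)))^*)%C.

Lemma strip_real f r t : strip f r t%:C = (nm (f (r%:C * expi t)) ^+ 2)%:C.
Proof.
rewrite /strip conjc_real mul_conjc; congr ((nm (f _) ^+ 2)%:C).
by rewrite /cexp /= !(mul0r, mul1r, mulr0, subr0, add0r, addr0) oppr0 expR0 mul1r.
Qed.

Lemma cdiff_strip f r w : 0 < r < 1 -> holo f -> `|complex.Im w| < - ln r -> cdiff (strip f r) w.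
Proof.
move=> /andP[r0 r1] hf hw.
have k u : `|complex.Im u| < - ln r -> cdiff (fun w => f (r%:C * cexp ('i%C * w))) u.
  move=> hu; apply: (cdiff_comp (g := fun w => r%:C * cexp ('i%C * w))).
    apply: hf; rewrite nmM nm_pos ?(ltW r0)// nm_cexp.
    have -> : complex.Re ('i * u) = - complex.Im u by case: u {hu} => a b /=; ring.
    rewrite -{1}[r]lnK ?posrE// -expRD -expR0 ltr_expR.
    by have := ler_norm (- complex.Im u); rewrite normrN; lra.
  apply: cdiffM; first exact: cdiff_cst.
  apply: (cdiff_comp (f := @cexp R)); first exact: cdiff_cexp.
  by apply: cdiffM; [exact: cdiff_cst|exact: cdiff_id].
apply: cdiffM; first exact: k.
apply: (cdiff_conj (f := fun w => f (r%:C * cexp ('i%C * w)))); apply: k.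
by case: w hw => a b /=; rewrite normrN.
Qed.

(** The disc of radius dl about t0 lies in the strip. Rescaled to the unit disc, the points of T
    fall into |v| <= 1/2, where the identity theorem applies. *)
Lemma strip_zeros f g (r : R) (T : set R) (t0 : R) (dl := - ln r) : 0 < r < 1 -> holo f -> holo g ->
  infinite_set T -> (forall t, T t -> `|t - t0| <= dl / 2 /\ nm (f (r%:C * expi t)) = nm (g (r%:C * expi t))) ->
  forall t, `|t - t0| < dl -> nm (f (r%:C * expi t)) = nm (g (r%:C * expi t)).
Proof.
move=> r01 hf hg iT hT; have /andP[r0 r1] := r01.
have dl0 : 0 < dl by rewrite /dl oppr_gt0 ln_lt0.
pose phi v := strip f r (t0%:C + dl%:C * v) - strip g r (t0%:C + dl%:C * v).
have hphi : holo phi.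
  move=> v v1.
  have k h : holo h -> cdiff (fun v => strip h r (t0%:C + dl%:C * v)) v.
    move=> hh; apply: (cdiff_comp (g := fun v => t0%:C + dl%:C * v)).
      apply: cdiff_strip => //; rewrite ImD ImcM /= add0r normrM gtr0_norm//.
      by rewrite gtr_pMr// (le_lt_trans (le_Im_nm v)).
    apply: cdiffD; first exact: cdiff_cst.
    by apply: cdiffM; [exact: cdiff_cst|exact: cdiff_id].
  by apply: cdiffB; exact: k.
have phiE t : phi ((t - t0) / dl)%:C =
    (nm (f (r%:C * expi t)) ^+ 2 - nm (g (r%:C * expi t)) ^+ 2)%:C.
  have e1 : t0 + dl * ((t - t0) / dl) = t by field; rewrite lt0r_neq0.
  rewrite /phi -rmorphM -rmorphD /= e1.
  by rewrite !strip_real -rmorphB.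
have phi0 : forall v, nm v < 1 -> phi v = 0.
  apply: (@holo_identity R phi (1 / 2) [set ((t - t0) / dl)%:C | t in T]) => //.
  - by lra.
  - apply: infinite_image => // x y _ _ /complexI /(mulIf _).
    by rewrite invr_eq0 lt0r_neq0// => /(_ isT) /addIr.
  move=> _ [t Tt <-]; have [h1 h2] := hT t Tt; split.
    by rewrite nm_real normrM normfV (gtr0_norm dl0) ler_pdivrMr//; lra.
  by rewrite phiE h2 subrr.
move=> t ht.
have : phi ((t - t0) / dl)%:C = 0.
  by apply: phi0; rewrite nm_real normrM normfV (gtr0_norm dl0) ltr_pdivrMr// mul1r.
rewrite phiE => /(congr1 (@complex.Re R)) /= /eqP; rewrite subr_eq0 eqrXn2 ?nm_ge0//.
by move/eqP.
Qed.

Lemma infinite_pigeonhole (T : set R) (dl : R) n a : 0 < dl ->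
  infinite_set (T `&` [set t | a <= t <= a + n%:R * dl]) ->
  exists t0 : R, infinite_set (T `&` [set t | `|t - t0| <= dl / 2]).
Proof.
move=> d0; elim: n a => [|n ih] a.
  rewrite mul0r addr0 => iT; exists a; apply: contra_not iT; apply: sub_finite_set.
  move=> t [Tt /= /andP[h1 h2]]; split => //=.
  by rewrite (_ : t = a) ?subrr ?normr0 ?divr_ge0 ?ltW//; apply/eqP; rewrite eq_le h2.
move=> iT; have [h1|h1] := pselect (finite_set (T `&` [set t | `|t - (a + dl / 2)| <= dl / 2])); last first.
  by exists (a + dl / 2).
apply: (ih (a + dl)) => h2; apply: iT.
have := conj h1 h2; rewrite -finite_setU; apply: sub_finite_set.
move=> t [Tt /= /andP[h3 h4]]; have [h5|h5] := leP t (a + dl).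
  by left; split => //=; rewrite ler_norml; apply/andP; split; lra.
right; split => //=; rewrite ltW//=; move: h4; rewrite -natr1; lra.
Qed.

(** A window of angles around some t0 contains infinitely many points of T. The equality spreads
    from it along the real line by dl / 2 per step, until every angle is reached. *)
Theorem circle_identity f g (r : R) (X : set R[i]) : 0 < r < 1 -> holo f -> holo g ->
  infinite_set X -> (forall z, X z -> nm z = r /\ nm (f z) = nm (g z)) ->
  forall z, nm z = r -> nm (f z) = nm (g z).
Proof.
move=> r01 hf hg iX hX; have /andP[r0 r1] := r01.
pose Z t := nm (f (r%:C * expi t)) = nm (g (r%:C * expi t)).
pose dl := - ln r.
have dl0 : 0 < dl by rewrite /dl oppr_gt0 ln_lt0.
pose T := [set t | 0 <= t < 2 * pi /\ X (r%:C * expi t)].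
have iT : infinite_set T.
  move=> fT; apply: iX; apply: (@sub_finite_set _ _ ((fun t => r%:C * expi t) @` T)).
    move=> z Xz; have [zr _] := hX z Xz; have [t ht zE] := exists_arg z.
    have zE' : r%:C * expi t = z by rewrite -zr -zE.
    by exists t => //; split => //; rewrite zE'.
  exact: finite_image.
have TZ t : T t -> Z t by move=> [_ /hX []].
have [t0 ht0] : exists t0 : R, infinite_set (T `&` [set t | `|t - t0| <= dl / 2]).
  pose n := Num.bound (2 * pi / dl).
  apply: (@infinite_pigeonhole T dl n 0) => //; apply: contra_not iT; apply: sub_finite_set.
  move=> t Tt; split => //=; have [/andP[h1 h2] _] := Tt; rewrite h1 add0r /=.
  apply/ltW/(lt_le_trans h2); rewrite -ler_pdivrMr//; apply/ltW/archi_boundP.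
  by rewrite divr_ge0 ?pi2_ge0// ltW.
have Z0 t : `|t - t0| < dl -> Z t.
  apply: (strip_zeros r01 hf hg ht0) => {}t [/TZ Zt /= ht]; by split.
have Zn n t : `|t - t0| < dl + n%:R * (dl / 2) -> Z t.
  elim: n t => [|n ih] t; first by rewrite mul0r addr0; exact: Z0.
  move=> ht.
  (* Here |t - t0| < (n+3) dl/2. Dividing the segment in the ratio n+1 to 2 puts t1 within (n+1)
     dl/2 of t0 and t within dl of t1, so an interval of half-width dl/2 about t1 is already covered
     by the induction. *)
  pose c : R := n.+1%:R / n.+3%:R.
  have c01 : 0 <= c by rewrite divr_ge0.
  have n3 : 0 < n.+3%:R :> R by rewrite ltr0n.
  have cE : 1 - c = 2 / n.+3%:R.
    have n30 := lt0r_neq0 n3; apply: (mulIf n30); rewrite /c mulrBl mul1r !divfK//.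
    by rewrite -[n.+3%:R]natr1 -[n.+2%:R]natr1; ring.
  pose t1 := t0 + c * (t - t0).
  have ht' : `|t - t0| < n.+3%:R * (dl / 2).
    by move: ht; rewrite -[n.+3%:R]natr1 -[n.+2%:R]natr1; lra.
  have k1 : `|t1 - t0| < n.+1%:R * (dl / 2).
    rewrite /t1 addrC addKr normrM (ger0_norm c01) /c mulrAC ltr_pdivrMr// -mulrA ltr_pM2l ?ltr0n//.
    by rewrite mulrC.
  have k2 : `|t - t1| < dl.
    rewrite (_ : t - t1 = (1 - c) * (t - t0)); last by rewrite /t1; ring.
    rewrite cE normrM ger0_norm ?divr_ge0// mulrAC ltr_pdivrMr//; lra.
  apply: (strip_zeros (t0 := t1) (T := [set t | t1 - dl / 2 < t < t1 + dl / 2]) r01 hf hg) => //.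
    by apply: infinite_itv; lra.
  move=> s /= /andP[s1 s2]; have st : `|s - t1| <= dl / 2 by rewrite ler_norml; apply/andP; split; lra.
  split => //; apply: ih; rewrite (_ : s - t0 = (s - t1) + (t1 - t0)); last by ring.
  apply: le_lt_trans (ler_normD _ _) _; move: k1; rewrite -natr1; lra.
move=> z zr; have [t _ ->] := exists_arg z; rewrite zr.
pose n := Num.bound (`|t - t0| / (dl / 2)).
apply: (Zn n); apply: lt_le_trans (_ : n%:R * (dl / 2) <= _); last by lra.
by rewrite -ltr_pdivrMr ?divr_gt0//; apply: archi_boundP; rewrite divr_ge0// ltW// divr_gt0.
Qed.

End CircleIdentity.

(** * Unimodular quotients on a circle *)

Section Unimodular.
Variable R : realType.
Implicit Types (f g : R[i] -> R[i]) (z w a : R[i]) (t r : R).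

Lemma rint_ge0 (a b : R) (u : R -> R) : (forall x, a <= x <= b -> 0 <= u x) -> 0 <= rint a b u.
Proof. by move=> h; apply: Rintegral_ge0 => x; rewrite /= in_itv /=; exact: h. Qed.

Lemma rint_eq0 (a b : R) (u : R -> R) : a < b -> (forall x, a <= x <= b -> rcont u x) ->
  (forall x, a <= x <= b -> 0 <= u x) -> rint a b u = 0 -> forall x, a <= x <= b -> u x = 0.
Proof.
move=> ab hu u0 i0 x xab; apply/eqP; rewrite eq_le u0// andbT leNgt; apply/negP => ux.
have ux2 : 0 < u x / 2 by rewrite divr_gt0.
have [d d0 hd] := hu x xab _ ux2.
pose p := Num.max a (x - d / 2); pose q := Num.min b (x + d / 2).
have d2 : 0 < d / 2 by rewrite divr_gt0.
have [xa xb] := andP xab.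
have ap : a <= p by rewrite le_max lexx.
have qb : q <= b by rewrite ge_min lexx.
have pq : p < q by rewrite gt_max !lt_min ab; apply/andP; split; apply/andP; split; lra.
have px : x - d / 2 <= p by rewrite le_max lexx orbT.
have qx : q <= x + d / 2 by rewrite ge_min lexx orbT.
have apb : a <= p <= b by rewrite ap (le_trans (ltW pq)).
have pqb : p <= q <= b by rewrite qb ltW.
have hpb y : p <= y <= b -> a <= y <= b by move=> /andP[h1 ->]; rewrite (le_trans ap).
have hpq y : p <= y <= q -> a <= y <= b by move=> /andP[h1 h2]; rewrite (le_trans ap)//= (le_trans h2).
have hap y : a <= y <= p -> a <= y <= b.
  by move=> /andP[-> h2]; rewrite (le_trans h2)//= (le_trans (ltW pq)).
have hqb y : q <= y <= b -> a <= y <= b by move=> /andP[h1 ->]; rewrite (le_trans _ h1)//= (le_trans ap (ltW pq)).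
have := i0; rewrite (rint_chasles apb)// (rint_chasles pqb); last by move=> y /hpb; exact: hu.
have h1 : 0 <= rint a p u by apply: rint_ge0 => y /hap; exact: u0.
have h2 : 0 <= rint q b u by apply: rint_ge0 => y /hqb; exact: u0.
have h3 : (q - p) * (u x / 2) <= rint p q u.
  rewrite -(rint_cst _ (ltW pq)); apply: le_rint => y yq; first exact: rcont_cst.
    by apply: hu; exact: hpq.
  have : `|y - x| < d by rewrite ltr_norml; have /andP[] := yq; move=> *; apply/andP; split; lra.
  by move/hd; rewrite ltr_norml => /andP[]; lra.
have : 0 < (q - p) * (u x / 2) by rewrite mulr_gt0// subr_gt0.
lra.
Qed.

(** On the circle 1/f is the conjugate of f; comparing the mean values of both gives |f(0)| = 1.
    Then 1 - Re (conj(f(0)) f) is nonnegative with mean zero, so it vanishes on the circle, and a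
    unimodular number with real part 1 is 1. *)
Lemma unimodular_const f r : 0 < r -> (forall z, nm z <= r -> cdiff f z) ->
  (forall z, nm z <= r -> f z != 0) -> (forall z, nm z = r -> nm (f z) = 1) ->
  nm (f 0) = 1 /\ forall z, nm z = r -> f z = f 0.
Proof.
move=> r0 hd hne h1.
have pi0 : 0 < 2 * pi :> R by rewrite mulr_gt0// pi_gt0.
have piC : (2 * pi)%:C != 0 :> R[i] by rewrite -nm_gt0 nm_pos// ltW.
have nr t : nm (r%:C * expi t) = r by rewrite nm_circle// ltW.
have nrl t : nm (r%:C * expi t) <= r by rewrite nr.
have f00 : f 0 != 0 by apply: hne; rewrite nm0 ltW.
have hc t : pcont (fun t => f (r%:C * expi t)) t by apply/pcont_on_circle/cdiff_ccont/hd.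
have m1 : circle_int f r = (2 * pi)%:C * f 0.
  by apply: (@circle_mean R [::]) => // z hz; [apply/cdiff_ccont/hd|move=> _; apply/hd/ltW].
have hdV z : nm z <= r -> cdiff (fun z => (f z)^-1) z.
  by move=> hz; apply: cdiffV; [exact: hne|exact: hd].
have m2 : circle_int (fun z => (f z)^-1) r = (2 * pi)%:C * (f 0)^-1.
  by apply: (@circle_mean R [::]) => // z hz; [apply/cdiff_ccont/hdV|move=> _; apply/hdV/ltW].
have conjE z : nm z = r -> (f z)^-1 = (f z)^*%C.
  by move=> zr; rewrite invc_norm nmE h1// rmorph1 expr1n invr1 mul1r.
have n0 : nm (f 0) = 1.
  have : ((circle_int f r)^*)%C = circle_int (fun z => (f z)^-1) r.
    by rewrite /circle_int -cint_conj//; apply: eq_cint => t _; rewrite conjE.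
  rewrite m1 m2 rmorphM => e'; have : (2 * pi)%:C * (f 0)^*%C = (2 * pi)%:C * (f 0)^-1.
    by rewrite -e'; congr (_ * _); apply/esym/conjc_real.
  move=> /(mulfI piC) e.
  have : f 0 * (f 0)^*%C = 1 by rewrite e divff.
  rewrite mul_conjc => /(congr1 (@complex.Re R)) /= /eqP.
  by rewrite sqrp_eq1 ?nm_ge0// => /eqP.
split => // z zr.
pose u t := 1 + (-1) * complex.Re ((f 0)^*%C * f (r%:C * expi t)).
have hcu t : rcont (fun t => complex.Re ((f 0)^*%C * f (r%:C * expi t))) t.
  by apply: pcont_Re; exact: pcontZ.
have hu t : rcont u t.
  by apply: rcontD; [exact: rcont_cst|apply: rcontM => //; exact: rcont_cst].
have n1 t : nm ((f 0)^*%C * f (r%:C * expi t)) = 1 by rewrite nmM nm_conj n0 h1// mulr1.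
have iu : rint 0 (2 * pi) u = 0.
  rewrite rintD; last 2 first.
  - by move=> t _; exact: rcont_cst.
  - by move=> t _; apply: rcontM => //; exact: rcont_cst.
  rewrite rint_cst ?ltW// rintZ//.
  have -> : rint 0 (2 * pi) (fun t => complex.Re ((f 0)^*%C * f (r%:C * expi t))) =
      complex.Re ((f 0)^*%C * circle_int f r) by rewrite /circle_int -cintZ.
  rewrite m1 mulrCA RecM mulrC.
  have -> : (f 0)^*%C * f 0 = 1 by rewrite mulrC mul_conjc n0 expr1n.
  by rewrite /=; ring.
have [t /andP[t0 t1] zE] := exists_arg z.
have ut : u t = 0.
  apply: (rint_eq0 pi0 (fun t _ => hu t) _ iu); last by rewrite t0 ltW.
  by move=> s _; rewrite /u; have := Re_le_nm ((f 0)^*%C * f (r%:C * expi s)); rewrite n1; lra.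
have e1 : (f 0)^*%C * f z = 1.
  rewrite zE zr; have := nm_sqr ((f 0)^*%C * f (r%:C * expi t)); rewrite n1.
  move: ut; rewrite /u; case: ((f 0)^*%C * f (r%:C * expi t)) => p q /= hp.
  have -> : p = 1 by lra.
  rewrite !expr1n => hq; have /eqP : q ^+ 2 = 0 by lra.
  by rewrite sqrf_eq0 => /eqP ->.
have : f 0 * (f 0)^*%C = 1 by rewrite mul_conjc n0 expr1n.
by move=> e2; rewrite -[f z]mul1r -e2 -mulrA e1 mulr1.
Qed.

(** Cancelling a common zero a on the circle loses the equality of moduli at a itself; a limit along
    the arc restores it. *)
Lemma eq_nm_at_circle_point f g r a : 0 < r -> nm a = r -> ccont f a -> ccont g a ->
  (forall z, nm z = r -> z != a -> nm (f z) = nm (g z)) -> nm (f a) = nm (g a).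
Proof.
move=> r0 ar hf hg h; have [t _ aE] := exists_arg a; rewrite ar in aE.
apply/eqP; rewrite -subr_eq0 -normr_le0; apply/ler_addgt0Pr => e e0; rewrite add0r.
have e2 : 0 < e / 2 by rewrite divr_gt0.
have k F : ccont F a -> rcont (fun t => nm (F (r%:C * expi t))) t.
  by move=> hF; apply/pcont_nm/pcont_on_circle; rewrite -aE.
have [d1 d10 h1] := k f hf _ e2; have [d2 d20 h2] := k g hg _ e2.
pose x := Num.min 1 (Num.min d1 d2) / 2.
have x0 : 0 < x by rewrite divr_gt0// !lt_min ltr01 d10 d20.
have x1 : 2 * x <= 1 by rewrite /x mulrC divfK// !ge_min lexx.
have xd1 : 2 * x <= d1 by rewrite /x mulrC divfK// !ge_min lexx ?orbT.
have xd2 : 2 * x <= d2 by rewrite /x mulrC divfK// !ge_min lexx ?orbT.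
have xt : `|(t + x) - t| = x by rewrite addrC addKr gtr0_norm.
have {h1} := h1 (t + x) ltac:(rewrite xt; lra); have {h2} := h2 (t + x) ltac:(rewrite xt; lra).
rewrite -aE.
have rC : r%:C != 0 :> R[i] by rewrite -nm_gt0 nm_pos// ltW.
have -> : nm (f (r%:C * expi (t + x))) = nm (g (r%:C * expi (t + x))).
  apply: h; first by rewrite nm_circle// ltW.
  apply/eqP; rewrite aE => /(mulfI rC); rewrite expiD => /(congr1 (fun u => (expi t)^-1 * u)).
  rewrite mulKf ?expi_neq0// mulVf ?expi_neq0// -expi0 => /expi_inj xx.
  have := @pi_ge2 R => pi2; have : x = 0 by apply: xx; apply/andP; split; lra.
  lra.
by rewrite !ltr_norml => /andP[? ?] /andP[? ?]; rewrite ler_norml; apply/andP; split; lra.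
Qed.

Lemma holo_horner (p : {poly R[i]}) : holo (fun z => p.[z]).
Proof. by move=> z _; exact: cdiff_horner. Qed.

Lemma holoM f g : holo f -> holo g -> holo (fun z => f z * g z).
Proof. by move=> hf hg z z1; apply: cdiffM; [exact: hf|exact: hg]. Qed.

Definition reflected (r : R) a : {poly R[i]} := ((r ^+ 2)%:C)%:P - (a^*) *: 'X.

Lemma reflectedE r a z : (reflected r a).[z] = (r ^+ 2)%:C - a^* * z.
Proof. by rewrite /reflected !hornerE. Qed.

Lemma reflected_neq0 r a z : 0 < r -> nm a < r -> nm z <= r -> (reflected r a).[z] != 0.
Proof.
move=> r0 ar zr; rewrite reflectedE -nm_gt0; apply: lt_le_trans (le_nmB _ _).
rewrite nm_pos ?sqr_ge0// nmM nm_conj subr_gt0 expr2.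
by apply: le_lt_trans (ler_wpM2l (nm_ge0 _) zr) _; rewrite ltr_pM2r.
Qed.

(* Zeros inside the disc are traded for factors r^2 - a^* z, of modulus
   r |z - a| on the circle; common zeros on the circle are cancelled. *)
Theorem circle_quotient_rational r : 0 < r < 1 -> forall N n m f g (U V : {poly R[i]}),
  (n + m <= N)%N -> holo f -> holo g -> ~ has_zeros f r n -> ~ has_zeros g r m ->
  (forall z, nm z <= r -> U.[z] != 0) -> (forall z, nm z <= r -> V.[z] != 0) ->
  (forall z, nm z = r -> nm (f z * U.[z]) = nm (g z * V.[z])) ->
  exists P Q : {poly R[i]}, [/\ P != 0, Q != 0 &
    forall z, nm z < 1 -> f z * Q.[z] = g z * P.[z]].
Proof.
move=> r01; have /andP[r0 r1] := r01.
have rC : r%:C != 0 :> R[i] by rewrite -nm_gt0 nm_pos// ltW.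
elim=> [|N ih] n m f g U V nmN hf hg nf ng hU hV hUV.
  move: nmN; rewrite leqn0 addn_eq0 => /andP[/eqP n0 _].
  by case: nf; rewrite n0; exact: has_zeros0.
(* A count of 0 always holds, so both failing counts are positive and each division may lower
   them. *)
case: n nmN nf => [|n] nmN nf; first by case: nf; exact: has_zeros0.
case: m nmN ng => [|m] nmN ng; first by case: ng; exact: has_zeros0.
have [[a [ar fa]]|fne] := pselect (exists a, nm a <= r /\ f a = 0).
  have a1 := le_lt_trans ar r1.
  have [h hh fE] := holo_divide hf a1 fa.
  have nh : ~ has_zeros h r n.
    by move=> hn; apply: nf; apply: (has_zeros_cons ar _ hn) => z _; exact: fE.
  have [arr|arr] := ltP (nm a) r.
    (* The constant r multiplying V balances |r^2 - conj(a) z| = r |z - a|. *)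
    have [|z zr|z zr|z zr|P [Q [P0 Q0 E]]] := ih n m.+1 h g (U * reflected r a) (V * (r%:C)%:P) _ hh hg nh ng.
    - by rewrite -ltnS.
    - by rewrite hornerM mulf_neq0 ?hU// reflected_neq0.
    - by rewrite hornerM hornerC mulf_neq0 ?hV.
    - rewrite !hornerM hornerC !mulrA nmM [in RHS]nmM -hUV// fE reflectedE.
      rewrite blaschke_circle ?(ltW r0)// !nmM nm_pos ?(ltW r0)//; ring.
    exists (P * ('X - a%:P)), Q; split => //; first by rewrite mulf_neq0// polyXsubC_eq0.
    by move=> z z1; rewrite fE hornerM hornerXsubC -mulrA E//; ring.
  (* On the circle itself V(a) is nonzero, so g vanishes at a as well and both functions are
     divided. *)
  have arE : nm a = r by apply/eqP; rewrite eq_le ar.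
  have ga : g a = 0.
    have := hUV a arE; rewrite fa mul0r nm0 => /esym/nm0_eq0/eqP.
    by rewrite mulf_eq0 (negbTE (hV a ar)) orbF => /eqP.
  have [k hk gE] := holo_divide hg a1 ga.
  have nk : ~ has_zeros k r m.
    by move=> hn; apply: ng; apply: (has_zeros_cons ar _ hn) => z _; exact: gE.
  have hUV' z : nm z = r -> nm (h z * U.[z]) = nm (k z * V.[z]).
    have aux w : nm w = r -> w != a -> nm (h w * U.[w]) = nm (k w * V.[w]).
      move=> wr wa; have := hUV w wr; rewrite fE gE -!mulrA nmM [in RHS]nmM => /mulfI; apply.
      by rewrite nm_eq0 subr_eq0.
    move=> zr; have [->|za] := eqVneq z a; last exact: aux.
    apply: (eq_nm_at_circle_point (f := fun z => h z * U.[z]) (g := fun z => k z * V.[z]) r0 arE) => //.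
      by apply: cdiff_ccont; apply: holoM => //; exact: holo_horner.
    by apply: cdiff_ccont; apply: holoM => //; exact: holo_horner.
  have [|P [Q [P0 Q0 E]]] := ih n m h k U V _ hh hk nh nk hU hV hUV'.
    by rewrite ltnW// -ltnS -addnS -addSn.
  exists P, Q; split => // z z1.
  by rewrite fE gE -!mulrA E.
have {}fne z : nm z <= r -> f z != 0.
  by move=> zr; apply/eqP => fz; apply: fne; exists z.
have [[a [ar ga]]|gne] := pselect (exists a, nm a <= r /\ g a = 0).
  have a1 := le_lt_trans ar r1.
  have arr : nm a < r.
    rewrite lt_neqAle ar andbT; apply/eqP => arE.
    have := hUV a arE; rewrite ga mul0r nm0 => /nm0_eq0/eqP.
    by rewrite mulf_eq0 (negbTE (hU a ar)) (negbTE (fne a ar)).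
  have [k hk gE] := holo_divide hg a1 ga.
  have nk : ~ has_zeros k r m.
    by move=> hn; apply: ng; apply: (has_zeros_cons ar _ hn) => z _; exact: gE.
  have [|z zr|z zr|z zr|P [Q [P0 Q0 E]]] := ih n.+1 m f k (U * (r%:C)%:P) (V * reflected r a) _ hf hk nf nk.
  - by rewrite -ltnS -addnS.
  - by rewrite hornerM hornerC mulf_neq0 ?hU.
  - by rewrite hornerM mulf_neq0 ?hV// reflected_neq0.
  - rewrite !hornerM hornerC !mulrA nmM [in RHS]nmM hUV// gE reflectedE.
    rewrite blaschke_circle ?(ltW r0)// !nmM nm_pos ?(ltW r0)//; ring.
  exists P, (Q * ('X - a%:P)); split => //; first by rewrite mulf_neq0// polyXsubC_eq0.
  by move=> z z1; rewrite gE hornerM hornerXsubC mulrA E//; ring.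
have {}gne z : nm z <= r -> g z != 0.
  by move=> zr; apply/eqP => gz; apply: gne; exists z.
pose phi z := (f z * U.[z]) / (g z * V.[z]).
have gV z : nm z <= r -> g z * V.[z] != 0 by move=> zr; rewrite mulf_neq0 ?gne ?hV.
have fU z : nm z <= r -> f z * U.[z] != 0 by move=> zr; rewrite mulf_neq0 ?fne ?hU.
have [n1 hphi] : nm (phi 0) = 1 /\ forall z, nm z = r -> phi z = phi 0.
  apply: unimodular_const => // z zr.
  - have z1 := le_lt_trans zr r1; apply: cdiffM.
      by apply: (holoM hf (@holo_horner U)).
    by apply: cdiffV; [exact: gV|apply: (holoM hg (@holo_horner V))].
  - by rewrite mulf_neq0 ?invr_eq0 ?gV ?fU.
  - by rewrite nmM nmV hUV// divff// nm_eq0 gV// zr.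
exists (phi 0 *: V), U.
have poly_neq0 (W : {poly R[i]}) : (forall z, nm z <= r -> W.[z] != 0) -> W != 0.
  by move=> hW; apply/eqP => W0; have := hW 0; rewrite W0 horner0 eqxx nm0 ltW// => /(_ isT).
split; [|exact: poly_neq0|].
  by rewrite scaler_eq0 negb_or -nm_gt0 n1 ltr01 poly_neq0.
move=> z z1; apply/eqP; rewrite -subr_eq0; apply/eqP.
apply: (@holo_identity R (fun z => f z * U.[z] - g z * (phi 0 *: V).[z]) r
   [set r%:C * expi t | t in [set t : R | 0 < t < 1]]) => //.
- by rewrite ltW.
- by move=> w w1; apply: cdiffB; apply: holoM => //; exact: holo_horner.
- apply: infinite_circle => //; first exact: infinite_itv.
  by move=> t /= /andP[t0 t1]; rewrite ltW//=; have := @pi_ge2 R; lra.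
move=> _ [t _ <-]; set w := _ * _; have wr : nm w = r by rewrite /w nm_circle// ltW.
split; first by rewrite wr.
rewrite hornerZ -(hphi w wr) /phi; apply/eqP; rewrite subr_eq0; apply/eqP.
have /gV : nm w <= r by rewrite wr.
by rewrite mulf_eq0 negb_or => /andP[g0 V0]; field; rewrite g0 V0.
Qed.

End Unimodular.

(** * Polynomials with equal moduli on two circles *)

Section CirclePolynomials.
Variable R : realType.
Implicit Types (P Q A B : {poly R[i]}) (X : set R[i]).

Lemma finite_roots P : P != 0 -> finite_set [set z | P.[z] = 0].
Proof.
move=> P0; apply: contrapT => /infinite_set_fsetP /(_ (size P)) [B hB].
rewrite leqNgt => /negP; apply.
apply: max_poly_roots => //; last exact: finmap.fset_uniq.
by apply/allP => z zB; apply/rootP; exact: hB.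
Qed.

Lemma poly_infinite_zeros P X : infinite_set X -> (forall z, X z -> P.[z] = 0) -> P = 0.
Proof.
move=> iX hX; apply/eqP; apply: contra_notT iX => /finite_roots; apply: sub_finite_set.
by move=> z /hX.
Qed.

(** Reversing the coefficients clears the denominators of P(c / z), which makes reflection in a
    circle a polynomial operation. *)
Lemma poly_inversion P n (c : R[i]) : (size P <= n.+1)%N ->
  exists P', forall z, z != 0 -> P'.[z] = z ^+ n * P.[c / z].
Proof.
move=> sP; exists (\sum_(i < n.+1) (P`_i * c ^+ i) *: 'X^(n - i)) => z z0.
rewrite horner_sum (horner_coef_wide _ sP) mulr_sumr; apply: eq_bigr => i _.
have ni : (i <= n)%N by rewrite -ltnS.
have -> : z ^+ n = z ^+ (n - i) * z ^+ i by rewrite -exprD subnK.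
by rewrite hornerZ hornerXn expr_div_n; field; rewrite expf_neq0.
Qed.

(** On |z| = r the conjugate of z is r^2 / z, so |P|^2 = |Q|^2 is a polynomial identity after
    multiplication by z^n, and infinitely many points suffice for it. *)
Lemma circle_reflection P Q (r : R) X : 0 < r -> infinite_set X ->
  (forall z, X z -> nm z = r /\ nm P.[z] = nm Q.[z]) ->
  forall z, z != 0 -> P.[z] * (map_poly conjc P).[(r ^+ 2)%:C / z] =
                      Q.[z] * (map_poly conjc Q).[(r ^+ 2)%:C / z].
Proof.
move=> r0 iX hX z z0.
pose n := maxn (size P) (size Q).
have [|P' hP'] := @poly_inversion (map_poly conjc P) n (r ^+ 2)%:C.
  by rewrite size_map_poly leqW// leq_maxl.
have [|Q' hQ'] := @poly_inversion (map_poly conjc Q) n (r ^+ 2)%:C.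
  by rewrite size_map_poly leqW// leq_maxr.
have E : P * P' - Q * Q' = 0.
  apply: (poly_infinite_zeros iX) => w /hX [wr hw].
  have w0 : w != 0 by rewrite -nm_gt0 wr.
  have cE : (r ^+ 2)%:C / w = conjc w by rewrite -wr -mul_conjc mulrAC divff// mul1r.
  have hc (W : {poly R[i]}) : W.[w] * (map_poly conjc W).[conjc w] = (nm W.[w] ^+ 2)%:C.
    by rewrite horner_map mul_conjc.
  by rewrite !(hornerD, hornerN, hornerZ, hornerM, horner_comp, hornerX, hornerXn, horner0) hP'// hQ'// cE mulrCA hc [X in _ - X]mulrCA hc hw subrr.
have := congr1 (fun W : {poly R[i]} => W.[z]) E; rewrite !(hornerD, hornerN, hornerZ, hornerM, horner_comp, hornerX, hornerXn, horner0) hP'// hQ'// mulrCA [X in _ - X]mulrCA.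
rewrite -mulrBr => /eqP; rewrite mulf_eq0 expf_eq0 (negbTE z0) andbF /= subr_eq0.
by move/eqP.
Qed.

(** After cancelling w^(a+b), the value at 0 reads q^b A(0) B(0) = q^a A(0) B(0). *)
Lemma scaling_valuation A B a b (q : R) : 0 < q < 1 ->
  A.[0] != 0 -> B.[0] != 0 ->
  (forall w, (A * 'X^a).[w] * (B * 'X^b).[q%:C * w] = (B * 'X^b).[w] * (A * 'X^a).[q%:C * w]) ->
  a = b.
Proof.
move=> /andP[q0 q1] A0 B0 h.
pose E := (q%:C ^+ b) *: (A * (B \Po (q%:C *: 'X))) - (q%:C ^+ a) *: (B * (A \Po (q%:C *: 'X))).
have E0 : E = 0.
  apply: (poly_infinite_zeros (X := [set (1 : R)%:C * expi t | t in [set t : R | 0 < t < 1]])).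
    apply: infinite_circle => //; first exact: infinite_itv.
    by move=> t /= /andP[t0 t1]; rewrite ltW//=; have := @pi_ge2 R; lra.
  move=> _ [t _ <-]; set w := _ * _.
  have w0 : w != 0 by rewrite -nm_gt0 nm_circle.
  clearbody w; have := h w; rewrite /E !(hornerD, hornerN, hornerZ, hornerM, horner_comp, hornerX, hornerXn, horner0) !exprMn => e.
  apply: (mulfI (expf_neq0 (a + b) w0)); rewrite mulr0 exprD.
  transitivity ((A.[w] * w ^+ a) * (B.[q%:C * w] * (q%:C ^+ b * w ^+ b)) -
    (B.[w] * w ^+ b) * (A.[q%:C * w] * (q%:C ^+ a * w ^+ a))); first by ring.
  by rewrite e subrr.
have := congr1 (fun W : {poly R[i]} => W.[0]) E0; rewrite /E !(hornerD, hornerN, hornerZ, hornerM, horner_comp, hornerX, hornerXn, horner0) mulr0 => /eqP.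
rewrite subr_eq0 [B.[0] * _]mulrC (inj_eq (mulIf _)) ?mulf_neq0// -!rmorphXn (inj_eq (@complexI R)).
case: (ltgtP a b) => // ab; first by rewrite lt_eqF// ltr_iXn2l.
by rewrite gt_eqF// ltr_iXn2l.
Qed.

Lemma valuation0 P : P != 0 -> exists n A, A.[0] != 0 /\ P = A * 'X^n.
Proof.
move=> P0; have [n [A]] := multiplicity_XsubC P 0; rewrite P0 /= => A0 PE.
by exists n, A; split; rewrite ?PE ?subr0//; move: A0; rewrite rootE.
Qed.

(** P and Q have the same order at 0; c cancels their lowest coefficients. The difference P - cQ
    satisfies the same relation with Q, so if nonzero it would have that order too, whereas its
    coefficient there is 0. *)
Lemma scaling_proportional P Q (q : R) : 0 < q < 1 -> P != 0 -> Q != 0 ->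
  (forall w, P.[w] * Q.[q%:C * w] = Q.[w] * P.[q%:C * w]) ->
  exists c : R[i], P = c *: Q.
Proof.
move=> q01 P0 Q0 h.
have [a [A [A0 PE]]] := valuation0 P0; have [b [B [B0 QE]]] := valuation0 Q0.
have ab : a = b by apply: (scaling_valuation q01 A0 B0) => w; rewrite -PE -QE.
subst b; pose c := A.[0] / B.[0]; exists c; apply/eqP; rewrite -subr_eq0.
apply/negPn/negP => D0; have [d [E [E0 DE]]] := valuation0 D0.
have da : d = a.
  apply: (scaling_valuation q01 E0 B0) => w; rewrite -DE -QE !(hornerD, hornerN, hornerZ, hornerM, horner_comp, hornerX, hornerXn, horner0).
  by rewrite mulrBl mulrBr h; ring.
have E00 : E.[0] = 0.
  have : E = A - c *: B.
    apply: (mulIf (x := 'X^a)); first by rewrite -size_poly_eq0 size_polyXn.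
    by rewrite -{1}da -DE PE QE mulrBl scalerAl.
  by move=> ->; rewrite !(hornerD, hornerN, hornerZ, hornerM, horner_comp, hornerX, hornerXn, horner0) /c divfK// subrr.
by rewrite E00 eqxx in E0.
Qed.

(** At w = 1/z the reflections in the two circles have arguments w and r^2 w. Eliminating P(z) and
    Q(z) between them leaves the scaling relation for the conjugated polynomials. *)
Theorem two_circles_proportional P Q (r : R) X Y : 0 < r < 1 -> P != 0 -> Q != 0 ->
  infinite_set X -> (forall z, X z -> nm z = 1 /\ nm P.[z] = nm Q.[z]) ->
  infinite_set Y -> (forall z, Y z -> nm z = r /\ nm P.[z] = nm Q.[z]) ->
  exists2 c : R[i], nm c = 1 & P = c *: Q.
Proof.
move=> /andP[r0 r1] P0 Q0 iX hX iY hY.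
have q01 : 0 < r ^+ 2 < 1 by rewrite exprn_gt0//= exprn_ilt1// ltW.
have h1 := circle_reflection ltr01 iX hX; have h2 := circle_reflection r0 iY hY.
pose Pc := map_poly conjc P; pose Qc := map_poly conjc Q.
have key w : Pc.[w] * Qc.[(r ^+ 2)%:C * w] = Qc.[w] * Pc.[(r ^+ 2)%:C * w].
  pose E := Pc * (Qc \Po ((r ^+ 2)%:C *: 'X)) - Qc * (Pc \Po ((r ^+ 2)%:C *: 'X)).
  suff : E = 0.
    move/(congr1 (fun W : {poly R[i]} => W.[w])); rewrite /E !(hornerD, hornerN, hornerZ, hornerM, horner_comp, hornerX, hornerXn, horner0).
    by move/eqP; rewrite subr_eq0 => /eqP.
  (* Away from the roots of PQ both values can be cancelled. *)
  pose Z := (X `\` [set z | (P * Q).[z] = 0]).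
  have iZ : infinite_set Z by apply: infinite_setD => //; apply: finite_roots; rewrite mulf_neq0.
  apply: (poly_infinite_zeros (X := (fun z => z^-1) @` Z)).
    by apply: infinite_image => // x y _ _; exact: invr_inj.
  move=> _ [z [Xz /= PQz] <-]; have [z1 _] := hX z Xz.
  have z0 : z != 0 by rewrite -nm_gt0 z1.
  have [Pz Qz] : P.[z] != 0 /\ Q.[z] != 0.
    by apply/andP; rewrite -negb_or -mulf_eq0 -hornerM; apply/eqP.
  rewrite /E !(hornerD, hornerN, hornerZ, hornerM, horner_comp, hornerX, hornerXn, horner0).
  have := h1 z z0; have := h2 z z0; rewrite -/Pc -/Qc expr1n [1%:C / z]mul1r => e2 e1.
  apply: (mulfI Pz); apply: (mulfI Qz); rewrite !mulr0.
  set p := Pc.[z^-1] in e1 *; set p' := Pc.[_ / z] in e2 *.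
  set k := Qc.[z^-1] in e1 *; set k' := Qc.[_ / z] in e2 *.
  have -> : Q.[z] * (P.[z] * (p * k' - k * p')) = (P.[z] * p) * (Q.[z] * k') - (Q.[z] * k) * (P.[z] * p') by ring.
  by rewrite e1 e2 subrr.
have [c PE] : exists c : R[i], P = c *: Q.
  apply: (scaling_proportional q01 P0 Q0) => w.
  have cc (W : {poly R[i]}) u : (map_poly conjc W).[conjc u] = conjc W.[u] by rewrite horner_map.
  have := key (conjc w); rewrite -[(r ^+ 2)%:C in X in X -> _]conjc_real -!rmorphM /=.
  by rewrite /Pc /Qc !cc -!rmorphM => /(can_inj (@conjcK R)).
exists c => //.
have [z [Xz /= Qz]] : (X `\` [set z | Q.[z] = 0]) !=set0.
  by apply: infinite_setN0; apply: infinite_setD => //; exact: finite_roots.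
have [_] := hX z Xz; rewrite PE hornerZ nmM => /(canRL (mulfK _)) -> //.
  by rewrite divff// nm_eq0; apply/eqP.
by rewrite nm_eq0; apply/eqP.
Qed.

End CirclePolynomials.

(** * The submean inequality for the square root of the modulus *)

Section BoundaryUniqueness.
Variable R : realType.
Implicit Types (f g h : R[i] -> R[i]) (z w : R[i]) (t rho : R).

Lemma rcont_comp (u v : R -> R) x : rcont u (v x) -> rcont v x -> rcont (fun y => u (v y)) x.
Proof.
by move=> hu hv e e0; have [d d0 h] := hu _ e0; have [d' d'0 h'] := hv _ d0; exists d' => // y /h' /h.
Qed.

Lemma rcont_sqrt (x : R) : rcont (@Num.sqrt R) x.
Proof. by apply/rcontP; exact: sqrt_continuous. Qed.

Definition root_abs h rho t : R := Num.sqrt (nm (h (rho%:C * expi t))).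

Lemma root_abs_ge0 h rho t : 0 <= root_abs h rho t.
Proof. exact: sqrtr_ge0. Qed.

Lemma root_abs_sqr h rho t : root_abs h rho t ^+ 2 = nm (h (rho%:C * expi t)).
Proof. by rewrite sqr_sqrtr// nm_ge0. Qed.

Lemma root_abs_cont h rho t : 0 <= rho < 1 -> holo h -> rcont (root_abs h rho) t.
Proof.
move=> /andP[r0 r1] hh; apply: (rcont_comp (u := @Num.sqrt R)); first exact: rcont_sqrt.
by apply/pcont_nm/pcont_on_circle/cdiff_ccont/hh; rewrite nm_circle.
Qed.

Lemma root_abs_periodic h rho t n : root_abs h rho (t + n%:R * (2 * pi)) = root_abs h rho t.
Proof.
rewrite /root_abs expiD; suff -> : expi (n%:R * (2 * pi)) = 1 :> R[i] by rewrite mulr1.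
elim: n => [|n ih]; first by rewrite mul0r expi0.
by rewrite -natr1 mulrDl mul1r expiD ih mul1r expi2pi.
Qed.

Lemma root_abs_uniform h rho : 0 <= rho < 1 -> holo h -> forall e : R, 0 < e ->
  exists2 d : R, 0 < d & forall t s, 0 <= t <= 2 * pi -> `|s - t| < d ->
    `|root_abs h rho s - root_abs h rho t| < e.
Proof.
move=> /andP[r0 r1] hh e e0.
(* Regarded as complex valued, so that [ccont_circle_uniform] applies. *)
pose F z := (Num.sqrt (nm (h z)))%:C.
have hF t : ccont F (rho%:C * expi t).
  move=> e1 e10; have [d d0 hd] := rcont_sqrt (nm (h (rho%:C * expi t))) e10.
  have hz : nm (rho%:C * expi t) < 1 by rewrite nm_circle.
  have [d' d'0 hd'] := cdiff_ccont (hh _ hz) d0; exists d' => // w /hd' hw.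
  rewrite /F -rmorphB nm_real; apply: hd; apply: le_lt_trans hw.
  set a := h w; set b := h _; have := le_nmB a b; have := le_nmB b a.
  by rewrite (nm_sub b a) ler_norml => *; apply/andP; split; lra.
have [d d0 hd] := ccont_circle_uniform hF e0.
have [d' d'0 hd'] := @pcont_expi R 0 _ d0.
exists d' => // t s ht st.
rewrite -nm_real rmorphB; apply: hd => //.
rewrite -mulrBr nmM nm_pos//; apply: le_lt_trans (_ : nm (expi s - expi t) < d).
  by rewrite ler_piMl ?nm_ge0// ltW.
have -> : expi s - expi t = expi t * (expi (s - t) - expi 0).
  have st' : s = t + (s - t) by ring.
  by rewrite {1}st' expiD expi0; ring.
by rewrite nmM nm_expi mul1r; apply: hd'; rewrite subr0.
Qed.

Section RiemannSum.
Variables (u : R -> R) (e d : R) (N : nat).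
Hypothesis N0 : (0 < N)%N.
Let eta : R := 2 * pi / N%:R.
Hypothesis eta_d : eta < d.
Hypothesis u0 : forall t, 0 <= u t.
Hypothesis hu : forall t, rcont u t.
Hypothesis hper : forall t n, u (t + n%:R * (2 * pi)) = u t.
Hypothesis hunif : forall t s, 0 <= t <= 2 * pi -> `|s - t| < d -> `|u s - u t| < e.

Let eta0 : 0 < eta.
Proof. by rewrite /eta divr_gt0// ?ltr0n// mulr_gt0// pi_gt0. Qed.

Let etaN : N%:R * eta = 2 * pi.
Proof. by rewrite /eta mulrC divfK// pnatr_eq0 -lt0n. Qed.

(** For t in [0, eta) each node t + k eta lies in its own cell, where u exceeds its value at the
    node minus e. *)
Let riemann_partial t n : 0 <= t < eta -> (n <= N)%N ->
  \sum_(k < n) eta * u (t + k%:R * eta) <= rint 0 (n%:R * eta) u + n%:R * eta * e.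
Proof.
move=> /andP[t0 t1]; elim: n => [_|n ih nN].
  by rewrite big_ord0 mul0r mul0r addr0; exact: rint_ge0.
have n1 : n%:R * eta <= n.+1%:R * eta by rewrite ler_pM2r// ler_nat.
have n0 : 0 <= n%:R * eta by rewrite mulr_ge0// ltW.
have nN2 : n.+1%:R * eta <= 2 * pi by rewrite -etaN ler_pM2r// ler_nat.
have nS : n.+1%:R * eta = n%:R * eta + eta by rewrite -natr1 mulrDl mul1r.
rewrite big_ord_recr /= (@rint_chasles R (n%:R * eta)) ?n0//.
have {}ih := ih (ltnW nN).
have : eta * (u (t + n%:R * eta) - e) <= rint (n%:R * eta) (n.+1%:R * eta) u.
  have <- : (n.+1%:R * eta - n%:R * eta) * (u (t + n%:R * eta) - e) =
    eta * (u (t + n%:R * eta) - e) by rewrite nS; ring.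
  rewrite -rint_cst//; apply: le_rint => x hx; [exact: rcont_cst|exact: hu|].
  have xt : `|x - (t + n%:R * eta)| < d.
    apply: le_lt_trans eta_d; rewrite ler_norml; move: hx; rewrite nS => /andP[x1 x2].
    by apply/andP; split; lra.
  have : 0 <= t + n%:R * eta <= 2 * pi by apply/andP; split; lra.
  by move=> /hunif/(_ xt); rewrite ltr_norml => /andP[]; lra.
rewrite nS; lra.
Qed.

(** The estimate is wanted for every starting angle: by periodicity of u, a shift by eta only
    permutes the nodes, which brings t into the first cell. *)
Lemma riemann_sum_le t : 0 <= t ->
  \sum_(k < N) u (t + k%:R * (2 * pi / N%:R)) <= N%:R * (rint 0 (2 * pi) u / (2 * pi) + e).
Proof.
rewrite -/eta => t0.
pose S x := \sum_(k < N) u (x + k%:R * eta).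
have SD x : S (x + eta) = S x.
  have : u x + S (x + eta) = S x + u (x + N%:R * eta).
    have <- : \sum_(k < N.+1) u (x + k%:R * eta) = S x + u (x + N%:R * eta) by rewrite big_ord_recr.
    rewrite big_ord_recl /= mul0r addr0; congr (_ + _); apply: eq_bigr => k _.
    by rewrite /bump /= add1n -natr1 mulrDl mul1r; congr (u _); ring.
  have := hper x 1; rewrite etaN mul1r => ->; rewrite [S x + _]addrC; exact: addrI.
have SDn x n : S (x + n%:R * eta) = S x.
  elim: n => [|n ih]; first by rewrite mul0r addr0.
  by rewrite -natr1 mulrDl mul1r addrA SD.
pose j := Num.truncn (t / eta).
have /andP[j1 j2] : j%:R <= t / eta < j.+1%:R by apply: truncn_itv; rewrite divr_ge0// ltW.
pose t' := t - j%:R * eta.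
have ht' : 0 <= t' < eta.
  move: j1 j2; rewrite ler_pdivlMr// ltr_pdivrMr// -natr1 mulrDl mul1r /t'.
  by move=> *; apply/andP; split; lra.
have := riemann_partial ht' (leqnn N); rewrite -mulr_sumr etaN.
have -> : \sum_(k < N) u (t' + k%:R * eta) = \sum_(k < N) u (t + k%:R * eta).
  by rewrite -/(S t') -/(S t) -(SDn t' j) /t' subrK.
have NR : 0 < N%:R :> R by rewrite ltr0n.
have pi0 : 0 < 2 * pi :> R by rewrite mulr_gt0// pi_gt0.
move=> h; rewrite -(ler_pM2l eta0); apply: le_trans h _.
have -> : eta * (N%:R * (rint 0 (2 * pi) u / (2 * pi) + e)) =
    (N%:R * eta) * (rint 0 (2 * pi) u / (2 * pi) + e) by ring.
have E (p I x : R) : p != 0 -> p * (I / p + x) = I + p * x by move=> p0; field.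
by rewrite etaN E// lt0r_neq0.
Qed.

End RiemannSum.

(* The product of the N rotations of h by N-th roots of unity, bounded on the
   circle by the AM-GM inequality, replaces the subharmonicity of |h|^(1/2). *)
Lemma root_mean_rotations h rho (m : R) N : (0 < N)%N -> 0 < rho < 1 -> holo h -> 0 <= m ->
  (forall t, 0 <= t -> \sum_(k < N) root_abs h rho (t + k%:R * (2 * pi / N%:R)) <= N%:R * m) ->
  Num.sqrt (nm (h 0)) <= m.
Proof.
move=> N0 /andP[r0 r1] hh m0 hm; pose eta : R := 2 * pi / N%:R.
have NR : 0 < N%:R :> R by rewrite ltr0n.
pose P z := \prod_(k <- enum 'I_N) h (expi (k%:R * eta) * z).
have Pd z : nm z <= rho -> cdiff P z.
  move=> zr; apply: cdiff_prod => k _; apply: (cdiff_comp (g := fun z => expi (k%:R * eta) * z)).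
    by apply: hh; rewrite nmM nm_expi mul1r (le_lt_trans zr).
  by apply: cdiffM; [exact: cdiff_cst|exact: cdiff_id].
have PM z : nm z = rho -> nm (P z) <= m ^+ 2 ^+ N.
  move=> zr; have [t /andP[t0 _] zE] := exists_arg z; rewrite zr in zE.
  have -> : nm (P z) = (\prod_(k < N) root_abs h rho (t + k%:R * eta)) ^+ 2.
    rewrite /P nm_prod big_enum /= -prodrXl; apply: eq_bigr => k _.
    by rewrite root_abs_sqr zE expiD; congr (nm (h _)); ring.
  rewrite -exprM mulnC exprM ler_pXn2r ?nnegrE ?exprn_ge0//; last first.
    by apply: prodr_ge0 => k _; exact: root_abs_ge0.
  have := @leif_AGM R 'I_N predT (fun k : 'I_N => root_abs h rho (t + k%:R * eta))
    (fun k _ => root_abs_ge0 _ _ _).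
  rewrite cardT size_enum_ord => -[h1 _]; apply: le_trans h1 _.
  rewrite ler_pXn2r ?nnegrE//; last first.
    by apply: divr_ge0 => //; apply: sumr_ge0 => k _; exact: root_abs_ge0.
  by rewrite ler_pdivrMr// mulrC; exact: hm.
have := @cauchy_bound R P rho (m ^+ 2 ^+ N) 0; rewrite nm0 subr0 divff ?lt0r_neq0// mulr1.
move=> /(_ r0 Pd PM).
have -> : nm (P 0) = nm (h 0) ^+ N.
  rewrite /P nm_prod big_enum /= (eq_bigr (fun=> nm (h 0))); last by move=> k _; rewrite mulr0.
  by rewrite prodr_const cardT size_enum_ord.
rewrite ler_pXn2r ?nnegrE ?nm_ge0 ?exprn_ge0// => hm2.
by rewrite -(ler_pXn2r (n := 2)) ?nnegrE ?sqrtr_ge0// sqr_sqrtr ?nm_ge0.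
Qed.

(** Sums over N rotations exceed N times the mean by at most N e once the mesh 2 pi / N is below the
    modulus of uniform continuity; then e is arbitrary. *)
Theorem root_submean h rho : 0 < rho < 1 -> holo h ->
  2 * pi * Num.sqrt (nm (h 0)) <= rint 0 (2 * pi) (root_abs h rho).
Proof.
move=> r01 hh; have /andP[r0 r1] := r01.
have r01' : 0 <= rho < 1 by rewrite ltW.
have pi0 : 0 < 2 * pi :> R by rewrite mulr_gt0// pi_gt0.
rewrite mulrC -ler_pdivlMr//; apply/ler_addgt0Pr => e e0.
have [d d0 hd] := root_abs_uniform r01' hh e0.
pose N := (Num.truncn (2 * pi / d)).+1.
have NR : 0 < N%:R :> R by rewrite ltr0n.
apply: (@root_mean_rotations h rho _ N) => //.
  by rewrite addr_ge0 ?(ltW e0)// divr_ge0 ?(ltW pi0)// rint_ge0// => t _; exact: root_abs_ge0.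
apply: (riemann_sum_le (d := d)) => //.
- by rewrite ltr_pdivrMr// -ltr_pdivrMl// [ltLHS]mulrC truncnS_gt.
- by move=> t; exact: root_abs_ge0.
- by move=> t; exact: root_abs_cont.
- by move=> t n; exact: root_abs_periodic.
Qed.

End BoundaryUniqueness.

(** * Null radial limits force a zero at the origin *)

Section HardyUniqueness.
Variable R : realType.
Implicit Types (f g h : R[i] -> R[i]) (z w : R[i]) (t rho M : R).

Definition radially_null h t := forall e : R, 0 < e ->
  exists2 d : R, 0 < d & forall rho, 1 - d < rho -> rho < 1 -> nm (h (rho%:C * expi t)) < e.

(** Radii start at 1/2 so that dividing h by z at most doubles the bound. *)
Definition mean_bounded h M := forall rho, 1 / 2 <= rho < 1 ->
  rint 0 (2 * pi) (fun t => nm (h (rho%:C * expi t))) <= M.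

Lemma rcont_min (u : R -> R) (K x : R) : rcont u x -> rcont (fun y => Num.min (u y) K) x.
Proof.
move=> hu e /hu [d d0 hd]; exists d => // y /hd; rewrite !ltr_norml => /andP[h1 h2].
by apply/andP; split; case: (leP (u y) K); case: (leP (u x) K) => *; lra.
Qed.

(** Truncating at K splits |h|^(1/2) into a part with integral at most M/K and a part dominated by K
    that tends to 0 almost everywhere. Hence 2 pi |h(0)|^(1/2) <= M/K for every K > 0. *)
Lemma radially_null_origin h M : holo h -> mean_bounded h M ->
  {ae @lebesgue_measure R, forall t : R, `[0%R, (2 * pi)%R]%classic t -> radially_null h t} ->
  h 0 = 0.
Proof.
move=> hh hM hrad.
have pi0 : 0 < 2 * pi :> R by rewrite mulr_gt0// pi_gt0.
pose rho n : R := 1 - n.+2%:R^-1.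
have rho01 n : 1 / 2 <= rho n < 1.
  have n2 : 0 < n.+2%:R :> R by rewrite ltr0n.
  have : n.+2%:R^-1 <= 2^-1 :> R by rewrite lef_pV2 ?posrE// ler_nat.
  have : 0 < n.+2%:R^-1 :> R by rewrite invr_gt0.
  by rewrite /rho; move: (n.+2%:R^-1) => q *; apply/andP; split; lra.
have rho0 n : 0 <= rho n < 1 by have /andP[] := rho01 n => *; apply/andP; split; lra.
have rho0' n : 0 < rho n < 1 by have /andP[] := rho01 n => *; apply/andP; split; lra.
pose c := Num.sqrt (nm (h 0)).
have hcirc n t : ccont h ((rho n)%:C * expi t).
  by have /andP[h1 h2] := rho0 n; apply/cdiff_ccont/hh; rewrite nm_circle.
have hnm n t : rcont (fun t => nm (h ((rho n)%:C * expi t))) t by apply/pcont_nm/pcont_on_circle.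
have M0 : 0 <= M.
  by apply: le_trans (hM _ (rho01 0)); apply: rint_ge0 => t _; exact: nm_ge0.
have key (K : R) : 0 < K -> 2 * pi * c <= M / K.
  move=> K0.
  pose v n t := Num.min (root_abs h (rho n) t) K.
  have hv n t : rcont (v n) t by apply: rcont_min; exact: root_abs_cont.
  have v0 n t : 0 <= v n t by rewrite le_min root_abs_ge0 ltW.
  have hn n : 2 * pi * c - M / K <= rint 0 (2 * pi) (v n).
    have h1 : 2 * pi * c <= rint 0 (2 * pi) (root_abs h (rho n)) := root_submean (rho0' n) hh.
    have h2 : rint 0 (2 * pi) (root_abs h (rho n)) <=
        rint 0 (2 * pi) (fun t => K^-1 * nm (h ((rho n)%:C * expi t)) + v n t).
      apply: le_rint => [t _|t _|t _]; first exact: root_abs_cont.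
        by apply: rcontD => //; apply: rcontM => //; exact: rcont_cst.
      rewrite -root_abs_sqr /v; set x := root_abs _ _ _.
      have x0 : 0 <= x := root_abs_ge0 _ _ _.
      have [xK|Kx] := leP x K; first by rewrite lerDr mulr_ge0 ?sqr_ge0// invr_ge0 ltW.
      have : x <= K^-1 * x ^+ 2.
        by rewrite mulrC ler_pdivlMr// expr2 ler_wpM2l// ltW.
      lra.
    have h3 : rint 0 (2 * pi) (fun t => K^-1 * nm (h ((rho n)%:C * expi t)) + v n t) =
        K^-1 * rint 0 (2 * pi) (fun t => nm (h ((rho n)%:C * expi t))) + rint 0 (2 * pi) (v n).
      rewrite rintD; [by rewrite rintZ| |by []].
      by move=> t _; apply: rcontM => //; exact: rcont_cst.
    have h4 : K^-1 * rint 0 (2 * pi) (fun t => nm (h ((rho n)%:C * expi t))) <= M / K.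
      by rewrite [leRHS]mulrC ler_pM2l ?invr_gt0//; exact: hM.
    rewrite h3 in h2; rewrite lerBlDl; apply: le_trans h1 (le_trans h2 _).
    by rewrite lerD2r.
  have cvgv : rint 0 (2 * pi) (v n) @[n --> \oo] --> (0 : R).
    have hae : {ae @lebesgue_measure R, forall t, `[0, 2 * pi]%classic t ->
        (fun n => (v n t)%:E) @ \oo --> (cst 0%E : R -> \bar R) t}.
      move: hrad; apply: (@filterS _ _ (ae_filter_ringOfSetsType (@lebesgue_measure R))) => t ht Dt; apply: cvg_EFin; first by apply: nearW.
      apply/cvgrPdist_lt => e e0; have e2 : 0 < e ^+ 2 by rewrite exprn_gt0.
      have [d d0 hd] := ht Dt _ e2.
      exists (Num.truncn d^-1) => // n /= dn.
      rewrite sub0r normrN ger0_norm//; apply: le_lt_trans (_ : root_abs h (rho n) t < e).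
        by rewrite ge_min lexx.
      rewrite -(ltr_pXn2r (n := 2)) ?nnegrE ?root_abs_ge0 ?(ltW e0)// root_abs_sqr.
      have /andP[r1 r2] := rho01 n; apply: hd => //.
      rewrite /rho ltrD2l ltrN2 invf_plt ?posrE ?ltr0n//.
      by apply: lt_le_trans (truncnS_gt _) _; rewrite ler_nat; exact: leq_trans dn (leqnSn _).
    have hle : {ae @lebesgue_measure R, forall t n, `[0, 2 * pi]%classic t ->
        (`|(v n t)%:E| <= (cst K%:E : R -> \bar R) t)%E}.
      apply: aeW => t n Dt /=; rewrite lee_fin ger0_norm//.
      by rewrite ge_min lexx orbT.
    have [_ _] := @dominated_convergence _ _ R (@lebesgue_measure R) `[0, 2 * pi]%classic
      (measurable_itv _) (fun n => EFin \o v n) (cst 0%E) (EFin \o (fun=> K))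
      (fun n => measurable_int _ (rint_integrable (fun t _ => hv n t)))
      (measurable_cst _) hae (rint_integrable (fun t _ => rcont_cst K t)) hle.
    by rewrite integral0 => hlim; apply: (fine_cvg hlim).
  rewrite -subr_le0 leNgt; apply/negP => x0.
  move/cvgrPdist_lt: cvgv => /(_ _ x0) [N _ /(_ N (leqnn N))].
  rewrite sub0r normrN ger0_norm; last by apply: rint_ge0 => t _.
  by have := hn N; lra.
have c0 : 0 <= c by exact: sqrtr_ge0.
suff c00 : c = 0.
  by apply: nm0_eq0; apply/eqP; rewrite eq_le nm_ge0 andbT -sqrtr_eq0; apply/eqP.
apply/eqP; rewrite eq_le c0 andbT leNgt; apply/negP => cpos.
have x0 : 0 < 2 * pi * c by rewrite mulr_gt0.
have M1 : 0 < M + 1 by lra.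
(* With this K the bound M/K is M / (M + 1) times 2 pi c, which is too small. *)
have := key ((M + 1) / (2 * pi * c)) (divr_gt0 M1 x0).
rewrite invf_div mulrA ler_pdivlMr// mulrC ler_pM2r//; lra.
Qed.

End HardyUniqueness.

(** * Boundary uniqueness and radial limits *)

Section BoundaryNull.
Variable R : realType.
Implicit Types (f g h : R[i] -> R[i]) (z w : R[i]) (t rho M : R).

(** A zero of every multiplicity at the origin is the case of radius 0 in [zeros_bounded]. *)
Theorem radially_null_eq0 g M : holo g -> mean_bounded g M ->
  {ae @lebesgue_measure R, forall t : R, `[0%R, (2 * pi)%R]%classic t -> radially_null g t} ->
  forall z, nm z < 1 -> g z = 0.
Proof.
move=> hg hM hrad; apply: (@zeros_bounded R g 0) => //; first by rewrite lexx ltr01.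
move=> n; elim: n g M hg hM hrad => [|n ih] g M hg hM hrad; first exact: has_zeros0.
have g0 := radially_null_origin hg hM hrad.
have [|h hh gE] := holo_divide hg _ g0; first by rewrite nm0.
have gE' z : g z = z * h z by rewrite gE subr0.
have pc (k : R[i] -> R[i]) rho t : holo k -> 0 <= rho < 1 -> rcont (fun t => nm (k (rho%:C * expi t))) t.
  move=> hk /andP[r0 r1]; apply/pcont_nm/pcont_on_circle/cdiff_ccont/hk.
  by rewrite nm_circle.
have hg2 rho t : 1 / 2 <= rho < 1 -> nm (h (rho%:C * expi t)) <= 2 * nm (g (rho%:C * expi t)).
  move=> /andP[r1 r2]; rewrite gE' nmM nm_circle; last by lra.
  have := nm_ge0 (h (rho%:C * expi t)); set x := nm _ => x0.
  have : 1 / 2 * x <= rho * x by rewrite ler_wpM2r.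
  lra.
apply: (@has_zeros_cons R g h 0 0); [by rewrite nm0|by move=> z _; exact: gE|].
apply: (ih h (2 * M)) => //.
  move=> rho r01; have r01' : 0 <= rho < 1 by have /andP[] := r01 => *; apply/andP; split; lra.
  apply: le_trans (_ : rint 0 (2 * pi) (fun t => 2 * nm (g (rho%:C * expi t))) <= _).
    apply: le_rint => t _; [exact: pc|apply: rcontM; [exact: rcont_cst|exact: pc]|exact: hg2].
  by rewrite rintZ; [rewrite ler_pM2l//; exact: hM|move=> t _; exact: pc].
move: hrad; apply: (@filterS _ _ (ae_filter_ringOfSetsType (@lebesgue_measure R))) => t ht Dt e e0.
have e2 : 0 < e / 2 by rewrite divr_gt0.
have [d d0 hd] := ht Dt _ e2.
exists (Num.min d (1 / 2)); first by rewrite lt_min d0; lra.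
move=> rho r1 r2.
have d1 : Num.min d (1 / 2) <= d by rewrite ge_min lexx.
have d2 : Num.min d (1 / 2) <= 1 / 2 by rewrite ge_min lexx orbT.
have := hd rho ltac:(lra) r2; have := @hg2 rho t; have -> : 1 / 2 <= rho < 1 by apply/andP; split; lra.
by move=> /(_ isT); lra.
Qed.

Lemma hardy1_holo f : hardy1 f -> holo f.
Proof.
by move=> [hf _] z z1; apply/derivable_cdiff/hf; rewrite nmE ltcR.
Qed.

Lemma hardy1_mean_bounded f : hardy1 f -> exists M, mean_bounded f M.
Proof.
move=> [_ [M hM]]; exists M => rho /andP[r1 r2].
have /hM : 0 <= rho < 1 by apply/andP; split; lra.
set I := (X in (X <= _)%E); have -> : rint 0 (2 * pi) (fun t => nm (f (rho%:C * expi t))) = fine I by [].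
move=> IM; rewrite -lee_fin fineK//.
(* A nonnegative integral bounded by M is finite, so [fine] does not collapse it to 0. *)
rewrite ge0_fin_numE; first exact: le_lt_trans IM (ltry _).
by apply: integral_ge0 => t _; rewrite lee_fin; exact: nm_ge0.
Qed.

Lemma radial_limitP f t (l : R[i]) : radial_limit f t l -> forall e : R, 0 < e ->
  exists2 d : R, 0 < d & forall rho, 1 - d < rho -> rho < 1 -> nm (f (rho%:C * expi t) - l) < e.
Proof.
move=> /cvgrPdist_lt h e e0; have /h : 0 < e%:C by rewrite ltcR.
rewrite near_withinE => /nbhs_ballP [d /= d0 hd]; exists d => // rho r1 r2.
have /hd : ball (1 : R) d rho by rewrite /ball /= gtr0_norm ?subr_gt0//; lra.
by move=> /(_ r2); rewrite nmE ltcR nm_sub.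
Qed.

(** The map [rad] folds a neighbourhood of 1 onto the radius at angle t, which turns a one-sided
    radial limit into continuity at 1, and [eq_of_ccont] gives the equality of limits. *)
Lemma radial_limit_quotient f g (P Q : {poly R[i]}) t lf lg :
  (forall z, nm z < 1 -> f z * Q.[z] = g z * P.[z]) ->
  radial_limit f t lf -> radial_limit g t lg -> lf * Q.[expi t] = lg * P.[expi t].
Proof.
move=> E hf hg.
pose rad w := (1 - nm (w - 1))%:C * expi t.
have rad1 : rad 1 = expi t by rewrite /rad subrr nm0 subr0 mul1r.
have rad_cont : ccont rad 1.
  move=> e e0; exists e => // w hw; rewrite /rad -mulrBl nmM nm_expi mulr1 -rmorphB nm_real.
  by rewrite subrr nm0 subr0 addrAC subrr add0r normrN ger0_norm// nm_ge0.
pose ext (k : R[i] -> R[i]) l w := if w == 1 then l else k (rad w).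
have ext_cont k l : radial_limit k t l -> ccont (ext k l) 1.
  move=> hk e e0; have [d d0 hd] := radial_limitP hk e0; exists d => // w wd.
  rewrite /ext eqxx; case: eqVneq => [_|w1]; first by rewrite subrr nm0.
  have w10 : 0 < nm (w - 1) by rewrite nm_gt0 subr_eq0.
  by apply: hd; lra.
have poly_cont (W : {poly R[i]}) : ccont (fun w => W.[rad w]) 1.
  by apply: (ccont_comp (f := fun z => W.[z])) => //; apply/cdiff_ccont/cdiff_horner.
have := @eq_of_ccont R (fun w => ext f lf w * Q.[rad w]) (fun w => ext g lg w * P.[rad w]) 1
  (ccontM (ext_cont _ _ hf) (poly_cont Q)) (ccontM (ext_cont _ _ hg) (poly_cont P)).
rewrite /ext eqxx rad1; apply; exists 1 => // w w1 hw; rewrite (negbTE w1); apply: E.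
have w10 : 0 < nm (w - 1) by rewrite nm_gt0 subr_eq0.
by rewrite nm_circle; lra.
Qed.

End BoundaryNull.

Theorem theorem2p8 (R : realType) (f g : R[i] -> R[i]) :
  hardy1 f -> hardy1 g ->
  (* |f| = |g| a.e. on T, in the sense of radial limits *)
  {ae @lebesgue_measure R, forall t : R, `[0%R, (2 * pi)%R]%classic t ->
     exists lf lg : R[i], radial_limit f t lf /\ radial_limit g t lg /\
                          `|lf| = `|lg| } ->
  (* |f| = |g| on an infinite subset X of rT for some 0 < r < 1 *)
  (exists r : R, 0 < r < 1 /\
     exists X : set R[i], infinite_set X /\
       X `<=` [set z | `|z| = r%:C] /\
       (forall z, X z -> `|f z| = `|g z|)) ->
  exists lambda : R[i], `|lambda| = 1 /\
    forall z : R[i], `|z| < 1 -> f z = lambda * g z.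
Proof.
move=> Hf Hg hae [r [r01 [X [iX [Xr XE]]]]].
have [r0 r1] := andP r01; have r01' : 0 <= r < 1 by rewrite ltW.
have hf := hardy1_holo Hf; have hg := hardy1_holo Hg.
have disc (z : R[i]) : `|z| < 1 -> nm z < 1 by rewrite nmE ltcR.
have hX z : X z -> nm z = r /\ nm (f z) = nm (g z).
  by move=> Xz; split; apply: complexI; rewrite -!nmE; [exact: Xr|exact: XE].
have circ := circle_identity r01 hf hg iX hX.
(* If g vanishes, so does f on X, hence everywhere, and any unimodular constant will do. *)
have [g0|/existsNP[z0 /not_implyP[z01 gz0]]] := pselect (forall z, nm z < 1 -> g z = 0).
  have f0 : forall z, nm z < 1 -> f z = 0.
    apply: (holo_identity r01' hf iX) => z Xz; have [zr zE] := hX z Xz; split; first by rewrite zr.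
    by apply: nm0_eq0; rewrite zE g0 ?nm0// zr.
  by exists 1; split; [rewrite normr1|move=> z /disc z1; rewrite f0// g0// mulr0].
have f0 : ~ forall z, nm z < 1 -> f z = 0.
  move=> f0; apply: gz0; apply: (holo_identity r01' hg iX) z01 => z Xz.
  have [zr zE] := hX z Xz; split; first by rewrite zr.
  by apply: nm0_eq0; rewrite -zE f0 ?nm0// zr.
have [n nf] : exists n, ~ has_zeros f r n.
  by apply: contrapT => /forallNP h; apply: f0; apply: (zeros_bounded r01' hf) => n; apply: contrapT; exact: h.
have [m ng] : exists m, ~ has_zeros g r m.
  apply: contrapT => /forallNP h; apply: gz0.
  by apply: (zeros_bounded r01' hg) z01 => k; apply: contrapT; exact: h.
have [|||P [Q [P0 Q0 E]]] := circle_quotient_rational r01 (U := 1) (V := 1) (leqnn (n + m)) hf hg nf ng.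
- by move=> z _; rewrite hornerC oner_neq0.
- by move=> z _; rewrite hornerC oner_neq0.
- by move=> z zr; rewrite hornerC !mulr1; exact: circ.
pose C := [set r%:C * expi t | t in [set t : R | 0 < t < 1]].
have C_itv : [set t : R | 0 < t < 1] `<=` [set t | 0 <= t < 2 * pi].
  by move=> t /= /andP[t0 t1]; rewrite ltW//=; have := @pi_ge2 R; lra.
have iC : infinite_set C by apply: infinite_circle => //; exact: infinite_itv.
have Cr z : C z -> nm z = r by move=> [t _ <-]; rewrite nm_circle// ltW.
(* Where f is nonzero on the arc, |f| = |g| can be cancelled from f Q = g P. *)
pose Y := C `\` [set z | C z /\ f z = 0].
have iY : infinite_set Y.
  apply: infinite_setD => //; apply: contrapT => iC0; apply: f0.
  by apply: (holo_identity r01' hf iC0) => z [Cz fz]; rewrite (Cr z Cz).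
have hY z : Y z -> nm z = r /\ nm P.[z] = nm Q.[z].
  move=> [Cz nfz]; have zr := Cr z Cz; split => //.
  have fz : nm (f z) != 0 by rewrite nm_eq0; apply/eqP => fz; apply: nfz.
  have := E z; rewrite zr => /(_ r1) /(congr1 (@nm R)); rewrite !nmM -(circ z zr).
  by move/(mulfI fz).
(* The half-open range keeps [expi] injective. If B were finite, g would have null radial limits
   almost everywhere. *)
pose B := [set t : R | 0 <= t < 2 * pi /\ exists lf lg : R[i],
  [/\ radial_limit f t lf, radial_limit g t lg, nm lf = nm lg & lg != 0]].
have iB : infinite_set B.
  move=> fB; apply: gz0; have [M gM] := hardy1_mean_bounded Hg.
  apply: (radially_null_eq0 hg gM) z01.
  have nB : {ae @lebesgue_measure R, forall t : R, ~ (B `|` [set 2 * pi]) t}.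
    (* The endpoint 2 pi belongs to the given range of angles but not to B, so it joins the null
       set. *)
    have cB : countable (B `|` [set (2 * pi : R)]).
      by apply: finite_set_countable; rewrite finite_setU; split => //; exact: finite_set1.
    exists (B `|` [set 2 * pi]); split.
    - exact: countable_measurable.
    - exact: countable_lebesgue_measure0.
    - by move=> t /= /contrapT.
  move: hae nB; apply: (@filterS2 _ _ (ae_filter_ringOfSetsType (@lebesgue_measure R))) => t ht nBt Dt.
  have [lf [lg [rf [rg lE]]]] := ht Dt.
  have lg0 : lg = 0.
    apply/eqP/negPn/negP => lg0; apply: nBt.
    move: Dt; rewrite /= in_itv /= => /andP[t0]; rewrite le_eqVlt => /orP[/eqP->|t1]; first by right.
    left; split; first by rewrite t0.
    by exists lf, lg; split => //; apply: complexI; rewrite -!nmE.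
  by move=> e e0; have [d d0 hd] := radial_limitP rg e0; exists d => // rho h1 h2; have := hd rho h1 h2; rewrite lg0 subr0.
pose Z := [set (1 : R)%:C * expi t | t in B].
have iZ : infinite_set Z by apply: infinite_circle => // t [].
have hZ z : Z z -> nm z = 1 /\ nm P.[z] = nm Q.[z].
  move=> [t [_ [lf [lg [rf rg lE lg0]]]] <-]; rewrite nm_circle// mul1r; split => //.
  have := congr1 (@nm R) (radial_limit_quotient E rf rg); rewrite !nmM lE => /mulfI -> //.
  by rewrite nm_eq0.
have [c c1 PE] := two_circles_proportional r01 P0 Q0 iZ hZ iY hY.
exists c; split; first by rewrite nmE c1.
move=> z /disc z1; apply/eqP; rewrite -subr_eq0; apply/eqP.
(* Off the roots of Q on the arc, f Q = g P = c g Q gives f = c g. *)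
apply: (holo_identity r01' (f := fun z => f z - c * g z) (X := C `\` [set z | Q.[z] = 0])) z1.
- by move=> w w1; apply: cdiffB; [exact: hf|apply: cdiffM; [exact: cdiff_cst|exact: hg]].
- by apply: infinite_setD => //; exact: finite_roots.
move=> w [Cw /= /eqP Qw]; rewrite (Cr w Cw); split => //.
have := E w; rewrite (Cr w Cw) => /(_ r1); rewrite PE hornerZ mulrA => /(mulIf Qw) ->.
by rewrite mulrC subrr.
Qed.
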